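(* Let $R$ be a left computable ring and let $\mathcal{A}:=R\text{-}\mathbf{fpres}$ be the Abelian category of finite left $R$-presentations. Then $\mathcal{A}$ is computable as an Abelian category with enough projectives.
   Context: Rings are associative with $1$, not necessarily commutative. All matrices are finite (with sizes allowed to be $0$). Composition convention: for $\phi:M\to L$ and $\psi:L\to N$ the composite $M\to N$ is written $\phi\psi$. **Left computable ring.** For $A\in R^{r_1\times r_0}$, $X=\mathtt{SyzygiesGenerators}(A)$ denotes a matrix $X\in R^{r_2\times r_1}$ whose rows generate the kernel of $R^{1\times r_1}\to R^{1\times r_0}$, $x\mapsto xA$. For $A\in R^{r_1\times r_0}$, $B\in R^{r_2\times r_0}$, $(N,T)=\mathtt{DecideZeroEffectively}(A,B)$ denotes matrices with $N=TA+B$ such that whenever the $i$-th row of $B$ is a left $R$-linear combination of the rows of $A$, the $i$-th row of $N$ is zero. A ring $R$ is left computable if any finite dimensional inhomogeneous linear system $XA=B$ over $R$ is effectively solvable in the sense that there exist algorithms computing $\mathtt{SyzygiesGenerators}(A)$ and $\mathtt{DecideZeroEffectively}(A,B)$. **The category $R\text{-}\mathbf{fpres}$.** Objects are finite matrices over $R$, where two matrices $\mathtt M\in R^{r_1\times r_0}$ and $\mathtt M'\in R^{r_1'\times r_0}$ with the same number of columns are identified to one object if $R^{1\times r_1}\mathtt M=R^{1\times r_1'}\mathtt M'$ as $R$-submodules of $R^{1\times r_0}$. For a matrix $\mathtt M\in R^{r_1\times r_0}$ put $\operatorname{coker}\mathtt M:=R^{1\times r_0}/R^{1\times r_1}\mathtt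 M$ (a left $R$-module). Morphisms from $\mathtt M\in R^{r_1\times r_0}$ to $\mathtt L\in R^{r_1'\times r_0'}$ are the $r_0\times r_0'$-matrices $\varphi$ over $R$ with $R^{1\times r_1}\mathtt M\varphi\le R^{1\times r_1'}\mathtt L$, where two matrices are identified to one morphism if they induce the same $R$-module homomorphism $\operatorname{coker}\mathtt M\to\operatorname{coker}\mathtt L$. Composition is matrix multiplication. For left computable $R$ this category is Abelian. Free modules used in constructions are given on a free set of generators: a free module of rank $r$ is presented by the empty matrix in $R^{0\times r}$. **Computable as an Abelian category.** An Abelian category $\mathcal A$ is computable as an Abelian category if all the existential quantifiers in the following list can be turned into constructive ones (i.e. realized by algorithms), the objects and morphisms being required to satisfy the usual universal properties: (1) for any object $M$ there exists an identity morphism $1_M$; (2) for any two composable morphisms $\phi,\psi$ there exists a composition $\phi\psi$; (3) there exists a zero object $0$; (4) for all objects $M,N$ there exists a zero morphism $0_{MN}$; (5) for all $M,N$ there exists an addition $(\phi,\psi)\mapsto\phi+\psi$ in the Abelian group $\operatorname{Hom}_{\mathcal A}(M,N)$; (6) for all $M,N$ there exists a subtraction $(\phi,\psi)\mapsto\phi-\psi$ in $\operatorname{Hom}_{\mathcal A}(M,N)$; (7) for all objects $A_1,A_2$ there exists a direct sum $A_1\oplus A_2$; (8) for all pairs $\phi_i:A_i\to M$, $i=1,2$, there exists a coproduct morphism $\langle\phi_1,\phi_2\rangle:A_1\oplus A_2\to M$; (9) for all pairs $\phi_i:M\to A_i$, $i=1,2$, there exists a product morphism $\{\phi_1,\phi_2\}:M\to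 A_1\oplus A_2$; (10) for any morphism $\phi:M\to N$ there exists a kernel $\kappa:\ker\phi\hookrightarrow M$, such that (11) for any morphism $\tau:L\to M$ with $\tau\phi=0$ there exists a unique lift $\tau_0:L\to\ker\phi$ with $\tau_0\kappa=\tau$; (12) for any morphism $\phi:M\to N$ there exists a cokernel $\epsilon:N\twoheadrightarrow\operatorname{coker}\phi$, such that (13) for any morphism $\eta:N\to L$ with $\phi\eta=0$ there exists a unique colift $\eta_0:\operatorname{coker}\phi\to L$ with $\epsilon\eta_0=\eta$. It is computable as an Abelian category with enough projectives if additionally the existential quantifiers in the following can be turned into constructive ones: (14) $P$ is called projective if for each morphism $\phi:P\to N$ and each morphism $\epsilon:M\to N$ with $\operatorname{im}\phi\le\operatorname{im}\epsilon$ there exists a projective lift $\phi_1:P\to M$ of $\phi$ along $\epsilon$, i.e. $\phi_1\epsilon=\phi$; (15) for each object $M$ there exists a projective hull, i.e. an epimorphism $\nu:P\twoheadrightarrow M$ with $P$ projective. *)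

(* Defs.v *)
From HB Require Import structures.
From mathcomp Require Import all_boot all_order all_algebra.
From mathcomp Require Import boolp.

Set Implicit Arguments.
Unset Strict Implicit.
Unset Printing Implicit Defensive.

Import GRing.Theory.
Local Open Scope ring_scope.
Local Open Scope quotient_scope.

(** An algorithm is rendered as a partial function between types of finite
    data, with value [None] where it does not terminate.  "Is computed by an
    algorithm" is an arbitrary predicate [computable] on partial functions with
    the closure properties of [algorithms] below: everything is stated for every
    such notion of algorithm.  If the elements of [R] are finitely encoded, with
    effective arithmetic and equality, Turing computability is one. *)

Record anymx (R : Type) := AnyMx {
  mx_rows : nat; mx_cols : nat; mx_val : 'M[R]_(mx_rows, mx_cols) }.

Notation Mx A := (AnyMx A).

Inductive dtype : Type :=
  DUnit | DBool | DNat | DMat | DPair of dtype & dtype.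

Notation "s ** t" := (DPair s t) (at level 40, left associativity).

Fixpoint data (R : Type) (s : dtype) : Type :=
  match s with
  | DUnit => unit
  | DBool => bool
  | DNat => nat
  | DMat => anymx R
  | DPair s t => (data R s * data R t)%type
  end.

Definition pfun (R : Type) (s t : dtype) := data R s -> option (data R t).

Definition returns (R : Type) (s t : dtype) (f : pfun R s t) (x : data R s)
  (Q : data R t -> Prop) : Prop := exists2 y, f x = Some y & Q y.

(** Nothing is required of the matrix operations on matrices of incompatible
    sizes: an algorithm may then return anything, or fail to terminate. *)
Record algorithms (R : pzRingType) := Algorithms {
  computable : forall s t : dtype, pfun R s t -> Prop;

  alg_id : forall s, @computable s s (fun x => Some x);
  alg_comp : forall s t u (f : pfun R s t) (g : pfun R t u),
    computable f -> computable g ->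
    @computable s u (fun x => obind g (f x));
  alg_tt : forall s, @computable s DUnit (fun=> Some tt);
  alg_pair : forall s t u (f : pfun R s t) (g : pfun R s u),
    computable f -> computable g ->
    @computable s (t ** u) (fun x => obind (fun y => omap (pair y) (g x)) (f x));
  alg_fst : forall s t, @computable (s ** t) s (fun x => Some x.1);
  alg_snd : forall s t, @computable (s ** t) t (fun x => Some x.2);

  alg_zero : @computable DUnit DNat (fun=> Some 0%N);
  alg_succ : @computable DNat DNat (fun n => Some n.+1);
  alg_rows : @computable DMat DNat (fun A => Some (mx_rows A));
  alg_cols : @computable DMat DNat (fun A => Some (mx_cols A));
  alg_mx0 : @computable (DNat ** DNat) DMat
    (fun mn => Some (Mx (0 : 'M[R]_(mn.1, mn.2))));
  alg_mx1 : @computable DNat DMat (fun n => Some (Mx (1%:M : 'M[R]_n)));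
  alg_oppmx : @computable DMat DMat (fun A => Some (Mx (- mx_val A)));
  alg_addmx : exists2 f : pfun R (DMat ** DMat) DMat, computable f &
    forall m n (A B : 'M[R]_(m, n)), f (Mx A, Mx B) = Some (Mx (A + B));
  alg_mulmx : exists2 f : pfun R (DMat ** DMat) DMat, computable f &
    forall m n p (A : 'M[R]_(m, n)) (B : 'M_(n, p)),
      f (Mx A, Mx B) = Some (Mx (A *m B));
  alg_row_mx : exists2 f : pfun R (DMat ** DMat) DMat, computable f &
    forall m n1 n2 (A : 'M[R]_(m, n1)) (B : 'M_(m, n2)),
      f (Mx A, Mx B) = Some (Mx (row_mx A B));
  alg_col_mx : exists2 f : pfun R (DMat ** DMat) DMat, computable f &
    forall m1 m2 n (A : 'M[R]_(m1, n)) (B : 'M_(m2, n)),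
      f (Mx A, Mx B) = Some (Mx (col_mx A B));
  alg_lsubmx : exists2 f : pfun R (DNat ** DMat) DMat, computable f &
    forall m n1 n2 (A : 'M[R]_(m, n1 + n2)),
      f (n1, Mx A) = Some (Mx (lsubmx A));
  alg_rsubmx : exists2 f : pfun R (DNat ** DMat) DMat, computable f &
    forall m n1 n2 (A : 'M[R]_(m, n1 + n2)),
      f (n1, Mx A) = Some (Mx (rsubmx A));
  alg_usubmx : exists2 f : pfun R (DNat ** DMat) DMat, computable f &
    forall m1 m2 n (A : 'M[R]_(m1 + m2, n)),
      f (m1, Mx A) = Some (Mx (usubmx A));
  alg_dsubmx : exists2 f : pfun R (DNat ** DMat) DMat, computable f &
    forall m1 m2 n (A : 'M[R]_(m1 + m2, n)),
      f (m1, Mx A) = Some (Mx (dsubmx A));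
  alg_eqmx : exists2 f : pfun R (DMat ** DMat) DBool, computable f &
    forall m n (A B : 'M[R]_(m, n)), f (Mx A, Mx B) = Some (A == B);
  (* Search, through the matrices [A] of a given size, for a solution of
     [p (x, Mx A)]; it terminates as soon as there is a solution, since the
     matrices of a given size, being finite data, can be enumerated. *)
  alg_search : forall s (p : pfun R (s ** DMat) DBool), computable p ->
    exists2 f : pfun R (s ** DNat ** DNat) DMat, computable f &
      forall x m n,
        (forall A : 'M[R]_(m, n), exists b, p (x, Mx A) = Some b) ->
        (exists A : 'M[R]_(m, n), p (x, Mx A) = Some true) ->
        exists A : 'M[R]_(m, n),
          f (x, m, n) = Some (Mx A) /\ p (x, Mx A) = Some true
}.

Arguments computable {R} _ {s t} _.

(** Membership in the left submodule [R^{1 x r} A] of [R^{1 x n}]. *)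
Definition rowsp (R : pzRingType) r n (A : 'M[R]_(r, n)) (x : 'rV[R]_n) : Prop :=
  exists y : 'rV[R]_r, x = y *m A.

Definition is_SyzygiesGenerators (R : pzRingType)
    (syz : pfun R DMat DMat) : Prop :=
  forall r1 r0 (A : 'M[R]_(r1, r0)),
    exists r2 (X : 'M[R]_(r2, r1)), syz (Mx A) = Some (Mx X) /\
      forall x : 'rV[R]_r1, x *m A = 0 <-> rowsp X x.

Definition is_DecideZeroEffectively (R : pzRingType)
    (dze : pfun R (DMat ** DMat) (DMat ** DMat)) : Prop :=
  forall r1 r2 r0 (A : 'M[R]_(r1, r0)) (B : 'M[R]_(r2, r0)),
    exists (N : 'M[R]_(r2, r0)) (T : 'M[R]_(r2, r1)),
      [/\ dze (Mx A, Mx B) = Some (Mx N, Mx T),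
          N = T *m A + B
        & forall i : 'I_r2, rowsp A (row i B) -> row i N = 0].

Definition left_computable (R : pzRingType) (C : algorithms R) : Prop :=
  (exists2 syz, computable C syz & is_SyzygiesGenerators syz) /\
  (exists2 dze, computable C dze & is_DecideZeroEffectively dze).

Declare Scope category_scope.
Delimit Scope category_scope with cat.

(** Diagrammatic order: [f ;; g] is first [f], then [g]. *)
Record preadditive := Preadditive {
  ob : Type;
  hom : ob -> ob -> zmodType;
  idm : forall M, hom M M;
  comp : forall L M N, hom L M -> hom M N -> hom L N;
  comp1m : forall M N (f : hom M N), comp (idm M) f = f;
  compm1 : forall M N (f : hom M N), comp f (idm N) = f;
  compA : forall K L M N (f : hom K L) (g : hom L M) (h : hom M N),
    comp f (comp g h) = comp (comp f g) h;
  compDl : forall L M N (f f' : hom L M) (g : hom M N),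
    comp (f + f') g = comp f g + comp f' g;
  compDr : forall L M N (f : hom L M) (g g' : hom M N),
    comp f (g + g') = comp f g + comp f g'
}.

Arguments hom {p} _ _.
Arguments idm {p} M.
Arguments comp {p L M N} _ _.

Notation "f ;; g" := (comp f g) (at level 40, left associativity) : category_scope.
Local Open Scope category_scope.

Section Abelian.
Variable A : preadditive.
Implicit Types L M N P S : ob A.

Definition mono M N (f : hom M N) : Prop :=
  forall L (g h : hom L M), g ;; f = h ;; f -> g = h.

Definition epi M N (f : hom M N) : Prop :=
  forall L (g h : hom N L), f ;; g = f ;; h -> g = h.

Definition zero_object (Z : ob A) : Prop :=
  forall M, (forall f : hom M Z, f = 0) /\ (forall f : hom Z M, f = 0).

Definition direct_sum A1 A2 S (i1 : hom A1 S) (i2 : hom A2 S)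
    (p1 : hom S A1) (p2 : hom S A2) : Prop :=
  [/\ forall M (f1 : hom A1 M) (f2 : hom A2 M),
        exists! f : hom S M, i1 ;; f = f1 /\ i2 ;; f = f2,
      forall M (f1 : hom M A1) (f2 : hom M A2),
        exists! f : hom M S, f ;; p1 = f1 /\ f ;; p2 = f2,
      i1 ;; p1 = idm A1 /\ i2 ;; p2 = idm A2
    & i1 ;; p2 = 0 /\ i2 ;; p1 = 0].

Definition is_kernel M N K (f : hom M N) (k : hom K M) : Prop :=
  k ;; f = 0 /\
  forall L (t : hom L M), t ;; f = 0 -> exists! t0 : hom L K, t0 ;; k = t.

Definition is_cokernel M N Q (f : hom M N) (e : hom N Q) : Prop :=
  f ;; e = 0 /\
  forall L (h : hom N L), f ;; h = 0 -> exists! h0 : hom Q L, e ;; h0 = h.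

Record abelian : Prop := Abelian {
  ab_zero : exists Z, zero_object Z;
  ab_sum : forall A1 A2, exists S (i1 : hom A1 S) (i2 : hom A2 S)
    (p1 : hom S A1) (p2 : hom S A2), direct_sum i1 i2 p1 p2;
  ab_ker : forall M N (f : hom M N), exists K (k : hom K M), is_kernel f k;
  ab_coker : forall M N (f : hom M N), exists Q (e : hom N Q), is_cokernel f e;
  ab_mono : forall M N (f : hom M N), mono f ->
    exists Q (e : hom N Q), is_kernel e f;
  ab_epi : forall M N (f : hom M N), epi f ->
    exists K (k : hom K M), is_cokernel k f
}.

Definition is_image M N I (f : hom M N) (i : hom I N) : Prop :=
  exists Q (e : hom N Q), is_cokernel f e /\ is_kernel e i.

(** Inclusion of images, as subobjects of [N]. *)
Definition im_le M M' N (f : hom M N) (g : hom M' N) : Prop :=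
  exists I J (i : hom I N) (j : hom J N),
    [/\ is_image f i, is_image g j & exists u : hom I J, u ;; j = i].

Definition projective P : Prop :=
  forall M N (f : hom P N) (e : hom M N), im_le f e ->
    exists f1 : hom P M, f1 ;; e = f.

End Abelian.

(** A data structure for a category: which data describe which objects and
    morphisms.  One object or morphism may be described by several data. *)
Record coded_category (R : pzRingType) := CodedCategory {
  ccat :> preadditive;
  obD : dtype;
  homD : dtype;
  codes_ob : data R obD -> ob ccat -> Prop;
  codes_hom : forall M N : ob ccat, data R homD -> hom M N -> Prop;
  codes_ob_inj : forall d M M', codes_ob d M -> codes_ob d M' -> M = M';
  codes_hom_inj : forall M N d (f f' : hom M N),
    codes_hom d f -> codes_hom d f' -> f = f';
  codes_ob_ex : forall M, exists d, codes_ob d M;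
  codes_hom_ex : forall M N (f : hom M N), exists d, codes_hom d f
}.

Section Computable.
Variables (R : pzRingType) (C : algorithms R) (A : coded_category R).
Implicit Types L M N P : ob A.

(** An algorithm is given a morphism together with its source and target. *)
Definition arrD : dtype := obD A ** homD A ** obD A.

Definition codes_arr M N (d : data R arrD) (f : hom M N) : Prop :=
  [/\ codes_ob d.1.1 M, codes_hom d.1.2 f & codes_ob d.2 N].

Record computable_abelian : Prop := ComputableAbelian {
  ca_abelian : abelian A;

  ca_id : exists2 F : pfun R (obD A) arrD, computable C F &
    forall M d, codes_ob d M ->
      returns F d (fun r => codes_arr r (idm M));

  ca_comp : exists2 F : pfun R (arrD ** arrD) arrD, computable C F &
    forall L M N (f : hom L M) (g : hom M N) d e,
      codes_arr d f -> codes_arr e g ->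
      returns F (d, e) (fun r => codes_arr r (f ;; g));

  ca_zero_ob : exists2 F : pfun R DUnit (obD A), computable C F &
    returns F tt (fun r => exists2 Z : ob A, codes_ob r Z & zero_object Z);

  ca_zero : exists2 F : pfun R (obD A ** obD A) arrD, computable C F &
    forall M N d e, codes_ob d M -> codes_ob e N ->
      returns F (d, e) (fun r => codes_arr r (0 : hom M N));

  ca_add : exists2 F : pfun R (arrD ** arrD) arrD, computable C F &
    forall M N (f g : hom M N) d e, codes_arr d f -> codes_arr e g ->
      returns F (d, e) (fun r => codes_arr r (f + g));

  ca_sub : exists2 F : pfun R (arrD ** arrD) arrD, computable C F &
    forall M N (f g : hom M N) d e, codes_arr d f -> codes_arr e g ->
      returns F (d, e) (fun r => codes_arr r (f - g));

  (* [Fcop] and [Fprd] return the coproduct and product morphisms relative to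
     the direct sum returned by [F]. *)
  ca_sum :
    exists (F : pfun R (obD A ** obD A) (arrD ** arrD ** arrD ** arrD))
           (Fcop Fprd : pfun R (arrD ** arrD) arrD),
    [/\ computable C F, computable C Fcop, computable C Fprd &
    forall (A1 A2 : ob A) a1 a2, codes_ob a1 A1 -> codes_ob a2 A2 ->
    exists (S : ob A) (i1 : hom A1 S) (i2 : hom A2 S)
           (p1 : hom S A1) (p2 : hom S A2),
    [/\ returns F (a1, a2) (fun r =>
          (codes_arr r.1.1.1 i1 /\ codes_arr r.1.1.2 i2) /\
          (codes_arr r.1.2 p1 /\ codes_arr r.2 p2)),
        direct_sum i1 i2 p1 p2,
        forall M (f1 : hom A1 M) (f2 : hom A2 M) h1 h2 m1 m2,
          codes_arr (a1, h1, m1) f1 -> codes_arr (a2, h2, m2) f2 ->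
          returns Fcop ((a1, h1, m1), (a2, h2, m2)) (fun r =>
            exists2 f : hom S M,
              codes_arr r f & i1 ;; f = f1 /\ i2 ;; f = f2)
      & forall M (f1 : hom M A1) (f2 : hom M A2) h1 h2 m1 m2,
          codes_arr (m1, h1, a1) f1 -> codes_arr (m2, h2, a2) f2 ->
          returns Fprd ((m1, h1, a1), (m2, h2, a2)) (fun r =>
            exists2 f : hom M S,
              codes_arr r f & f ;; p1 = f1 /\ f ;; p2 = f2)]];

  (* [Flift] lifts along the kernel embedding returned by [F]; uniqueness of
     the lift is part of [is_kernel]. *)
  ca_ker : exists (F : pfun R arrD arrD) (Flift : pfun R (arrD ** arrD) arrD),
    [/\ computable C F, computable C Flift &
    forall M N (f : hom M N) d, codes_arr d f ->
    exists (K : ob A) (k : hom K M),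
    [/\ returns F d (fun r => codes_arr r k),
        is_kernel f k
      & forall L (t : hom L M) e, codes_arr e t -> t ;; f = 0 ->
          returns Flift (d, e) (fun r =>
            exists2 t0 : hom L K, codes_arr r t0 & t0 ;; k = t)]];

  ca_coker : exists (F : pfun R arrD arrD) (Flift : pfun R (arrD ** arrD) arrD),
    [/\ computable C F, computable C Flift &
    forall M N (f : hom M N) d, codes_arr d f ->
    exists (Q : ob A) (c : hom N Q),
    [/\ returns F d (fun r => codes_arr r c),
        is_cokernel f c
      & forall L (h : hom N L) e, codes_arr e h -> f ;; h = 0 ->
          returns Flift (d, e) (fun r =>
            exists2 h0 : hom Q L, codes_arr r h0 & c ;; h0 = h)]]
}.

Record computable_abelian_enough_projectives : Prop :=
  ComputableAbelianEnoughProjectives {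
  cap_abelian : computable_abelian;

  (* [P] is any projective object, given by any of its codes, not only one
     returned by the algorithm of [cap_hull]. *)
  cap_lift : exists2 F : pfun R (arrD ** arrD) arrD, computable C F &
    forall P M N (f : hom P N) (g : hom M N) d e, projective P ->
      codes_arr d f -> codes_arr e g -> im_le f g ->
      returns F (d, e) (fun r =>
        exists2 f1 : hom P M, codes_arr r f1 & f1 ;; g = f);

  cap_hull : exists2 F : pfun R (obD A) arrD, computable C F &
    forall M d, codes_ob d M ->
      returns F d (fun r => exists (P : ob A) (nu : hom P M),
        [/\ codes_arr r nu, epi nu & projective P])
}.

End Computable.

Section Presentations.
Variable R : pzRingType.

(** Objects: matrices, where matrices with the same number of columns are
    identified when their rows generate the same submodule. *)

Definition pres (n : nat) : Type := {r : nat & 'M[R]_(r, n)}.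
HB.instance Definition _ n := Choice.on (pres n).

Definition pres_eq n (A B : pres n) : bool :=
  `[< forall x, rowsp (tagged A) x <-> rowsp (tagged B) x >].

Lemma pres_eq_refl n : reflexive (@pres_eq n).
Proof. by move=> A; apply/asboolP. Qed.

Lemma pres_eq_sym n : symmetric (@pres_eq n).
Proof.
move=> A B; apply/asboolP/asboolP => H x; split=> Hx;
  by [apply/(H x) | apply: (proj1 (H x)) | apply: (proj2 (H x))].
Qed.

Lemma pres_eq_trans n : transitive (@pres_eq n).
Proof.
move=> B A D /asboolP HAB /asboolP HBD; apply/asboolP => x.
exact: iff_trans (HAB x) (HBD x).
Qed.

Canonical pres_eq_equiv n :=
  EquivRel (@pres_eq n) (@pres_eq_refl n) (@pres_eq_sym n) (@pres_eq_trans n).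

Definition fp_ob : Type := {n : nat & {eq_quot (@pres_eq n)}}.

Definition fpob r n (A : 'M[R]_(r, n)) : fp_ob :=
  existT (fun n => {eq_quot (@pres_eq n)}) n
    (\pi_{eq_quot (@pres_eq n)} (existT _ r A)).

(** Number of generators (columns) and module of relations of an object. *)
Definition gens (X : fp_ob) : nat := tag X.
Definition rels (X : fp_ob) : 'rV[R]_(gens X) -> Prop :=
  rowsp (tagged (repr (tagged X))).

Lemma relsE r n (A : 'M[R]_(r, n)) (x : 'rV_n) :
  @rels (fpob A) x <-> rowsp A x.
Proof.
rewrite /rels /=.
have /eqP := reprK (\pi_{eq_quot (@pres_eq n)} (existT _ r A)).
by rewrite eqmodE => /asboolP.
Qed.

Lemma fpob_eq r1 r2 n (A : 'M[R]_(r1, n)) (B : 'M[R]_(r2, n)) :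
  fpob A = fpob B <-> forall x, rowsp A x <-> rowsp B x.
Proof.
split=> [eqAB x|eqAB].
  have relsB (X : fp_ob) (e : gens X = n) : X = fpob B ->
      @rels X (castmx (erefl, esym e) x) <-> rowsp B x.
    by move=> eqX; subst X; rewrite (eq_axiomK e) castmx_id; exact: relsE.
  by rewrite -(relsB (fpob A) erefl eqAB) castmx_id; exact: iff_sym (relsE _ _).
by congr existT; apply/eqmodP/asboolP.
Qed.

Lemma fpob_ex (X : fp_ob) : exists r (A : 'M[R]_(r, gens X)), X = fpob A.
Proof.
case: X => n a; exists (tag (repr a)), (tagged (repr a)); rewrite /fpob.
by congr existT; rewrite -[LHS]reprK; congr \pi; case: (repr a).
Qed.

Lemma rels0 X : rels (0 : 'rV_(gens X)).
Proof. by exists 0; rewrite mul0mx. Qed.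

Lemma relsD X (x y : 'rV_(gens X)) : rels x -> rels y -> rels (x + y).
Proof. by move=> [u ->] [v ->]; exists (u + v); rewrite mulmxDl. Qed.

Lemma relsN X (x : 'rV_(gens X)) : rels x -> rels (- x).
Proof. by move=> [u ->]; exists (- u); rewrite mulNmx. Qed.

(** Morphisms: matrices that map relations to relations, where matrices are
    identified when they induce the same map between the cokernels. *)

Definition maps (X Y : fp_ob) : {pred 'M[R]_(gens X, gens Y)} :=
  fun phi => `[< forall x, rels x -> rels (x *m phi) >].

Lemma maps_zmod X Y : zmod_closed (@maps X Y).
Proof.
split=> [|phi psi /asboolP Hphi /asboolP Hpsi]; apply/asboolP => x Hx.
  by rewrite mulmx0; exact: rels0.
by rewrite mulmxBr; apply: relsD; [exact: Hphi | apply: relsN; exact: Hpsi].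
Qed.

HB.instance Definition _ X Y :=
  GRing.isZmodClosed.Build _ (@maps X Y) (@maps_zmod X Y).

Definition fp_mx (X Y : fp_ob) : Type := {phi | phi \in @maps X Y}.
HB.instance Definition _ X Y := SubChoice.on (fp_mx X Y).
HB.instance Definition _ X Y := [SubChoice_isSubZmodule of fp_mx X Y by <:].

(** [phi] induces the zero map between the cokernels. *)
Definition null (X Y : fp_ob) : {pred fp_mx X Y} :=
  fun phi => `[< forall x, @rels Y (x *m val phi) >].

Lemma null_zmod X Y : zmod_closed (@null X Y).
Proof.
split=> [|phi psi /asboolP Hphi /asboolP Hpsi]; apply/asboolP => x.
  by rewrite (_ : val (0 : fp_mx X Y) = 0) // mulmx0; exact: rels0.
rewrite (_ : val (phi - psi) = val phi - val psi) // mulmxBr.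
by apply: relsD; [exact: Hphi | apply: relsN; exact: Hpsi].
Qed.

HB.instance Definition _ X Y :=
  GRing.isZmodClosed.Build _ (@null X Y) (@null_zmod X Y).

Definition fp_hom (X Y : fp_ob) : zmodType := Quotient.quot (@null X Y).

Definition fphom X Y (phi : fp_mx X Y) : fp_hom X Y := \pi_(fp_hom X Y) phi.

(** Two matrices give the same morphism iff they induce the same map between
    the cokernels. *)
Lemma fphom_eq X Y (phi psi : fp_mx X Y) :
  fphom phi = fphom psi <-> forall x, @rels Y (x *m val phi - x *m val psi).
Proof.
rewrite /fphom; split=> [/eqP|H].
  rewrite -Quotient.idealrBE => /asboolP H x.
  by move: (H x); rewrite (_ : val (phi - psi) = val phi - val psi) // mulmxBr.
apply/eqP; rewrite -Quotient.idealrBE; apply/asboolP => x.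
by rewrite (_ : val (phi - psi) = val phi - val psi) // mulmxBr.
Qed.

Lemma fphom_repr X Y (f : fp_hom X Y) : fphom (repr f) = f.
Proof. exact: reprK. Qed.

Lemma fphomD X Y (phi psi : fp_mx X Y) :
  fphom (phi + psi) = fphom phi + fphom psi.
Proof. by rewrite /fphom raddfD. Qed.

Lemma maps1 X : 1%:M \in @maps X X.
Proof. by apply/asboolP => x; rewrite mulmx1. Qed.

Lemma mapsM X Y Z (phi : fp_mx X Y) (psi : fp_mx Y Z) :
  val phi *m val psi \in @maps X Z.
Proof.
apply/asboolP => x Hx; rewrite mulmxA.
by move/asboolP: (valP psi); apply; move/asboolP: (valP phi); apply.
Qed.

Definition fp_mx1 X : fp_mx X X := exist _ 1%:M (maps1 X).
Definition fp_mxM X Y Z (phi : fp_mx X Y) (psi : fp_mx Y Z) : fp_mx X Z :=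
  exist _ (val phi *m val psi) (mapsM phi psi).

Definition fp_id X : fp_hom X X := fphom (fp_mx1 X).
Definition fp_comp X Y Z (f : fp_hom X Y) (g : fp_hom Y Z) : fp_hom X Z :=
  fphom (fp_mxM (repr f) (repr g)).

Lemma fp_compE X Y Z (phi : fp_mx X Y) (psi : fp_mx Y Z) :
  fp_comp (fphom phi) (fphom psi) = fphom (fp_mxM phi psi).
Proof.
apply/fphom_eq => x /=; rewrite !mulmxA.
have /fphom_eq/(_ x) Hphi := fphom_repr (fphom phi).
have /fphom_eq Hpsi := fphom_repr (fphom psi).
rewrite -(subrKA (x *m val phi *m val (repr (fphom psi)))) -mulmxBl.
apply: relsD; last exact: Hpsi.
by move/asboolP: (valP (repr (fphom psi))); apply.
Qed.

Lemma fphomP X Y (f : fp_hom X Y) : exists phi, f = fphom phi.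
Proof. by exists (repr f); rewrite fphom_repr. Qed.

Lemma fp_comp1m X Y (f : fp_hom X Y) : fp_comp (fp_id X) f = f.
Proof.
have [phi ->] := fphomP f; rewrite fp_compE; apply/fphom_eq => x /=.
by rewrite mul1mx subrr; exact: rels0.
Qed.

Lemma fp_compm1 X Y (f : fp_hom X Y) : fp_comp f (fp_id Y) = f.
Proof.
have [phi ->] := fphomP f; rewrite fp_compE; apply/fphom_eq => x /=.
by rewrite mulmx1 subrr; exact: rels0.
Qed.

Lemma fp_compA X Y Z W (f : fp_hom X Y) (g : fp_hom Y Z) (h : fp_hom Z W) :
  fp_comp f (fp_comp g h) = fp_comp (fp_comp f g) h.
Proof.
have [phi ->] := fphomP f; have [psi ->] := fphomP g; have [chi ->] := fphomP h.
rewrite !fp_compE; apply/fphom_eq => x /=.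
by rewrite !mulmxA subrr; exact: rels0.
Qed.

Lemma fp_compDl X Y Z (f f' : fp_hom X Y) (g : fp_hom Y Z) :
  fp_comp (f + f') g = fp_comp f g + fp_comp f' g.
Proof.
have [phi ->] := fphomP f; have [phi' ->] := fphomP f'.
have [psi ->] := fphomP g.
rewrite -fphomD !fp_compE -fphomD; apply/fphom_eq => x.
have -> : val (fp_mxM (phi + phi') psi) = val (fp_mxM phi psi + fp_mxM phi' psi).
  exact: mulmxDl.
by rewrite subrr; exact: rels0.
Qed.

Lemma fp_compDr X Y Z (f : fp_hom X Y) (g g' : fp_hom Y Z) :
  fp_comp f (g + g') = fp_comp f g + fp_comp f g'.
Proof.
have [phi ->] := fphomP f; have [psi ->] := fphomP g.
have [psi' ->] := fphomP g'.
rewrite -fphomD !fp_compE -fphomD; apply/fphom_eq => x.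
have -> : val (fp_mxM phi (psi + psi')) = val (fp_mxM phi psi + fp_mxM phi psi').
  exact: mulmxDr.
by rewrite subrr; exact: rels0.
Qed.

Definition fpres : preadditive :=
  Preadditive fp_comp1m fp_compm1 fp_compA fp_compDl fp_compDr.

(** An object is described by any matrix presenting it, a morphism by any
    matrix inducing it. *)
Definition fp_codes_ob (d : data R DMat) (X : ob fpres) : Prop :=
  fpob (mx_val d) = X.
Definition fp_codes_hom (X Y : ob fpres) (d : data R DMat) (f : hom X Y) : Prop :=
  exists phi : fp_mx X Y, d = Mx (val phi) /\ f = fphom phi.

Lemma fp_codes_ob_inj d X X' : fp_codes_ob d X -> fp_codes_ob d X' -> X = X'.
Proof. by move=> <- <-. Qed.

Lemma anymx_inj m n (A B : 'M[R]_(m, n)) : Mx A = Mx B -> A = B.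
Proof.
have E (a b : anymx R) : a = b ->
    exists e, castmx e (mx_val a) = mx_val b.
  by move=> ->; exists (erefl, erefl); rewrite castmx_id.
move=> /E[/= [e e'] <-].
by rewrite (eq_axiomK e) (eq_axiomK e') castmx_id.
Qed.

Lemma fp_codes_hom_inj (X Y : ob fpres) d (f f' : hom X Y) :
  fp_codes_hom d f -> fp_codes_hom d f' -> f = f'.
Proof.
move=> [phi [-> ->]] [psi [/anymx_inj eqpp ->]].
by congr fphom; exact: val_inj.
Qed.

Lemma fp_codes_ob_ex X : exists d, fp_codes_ob d X.
Proof. by have [r [A ->]] := fpob_ex X; exists (Mx A). Qed.

Lemma fp_codes_hom_ex (X Y : ob fpres) (f : hom X Y) :
  exists d, fp_codes_hom d f.
Proof. by have [phi ->] := fphomP f; exists (Mx (val phi)), phi. Qed.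

Definition fpres_coded : coded_category R :=
  CodedCategory fp_codes_ob_inj fp_codes_hom_inj fp_codes_ob_ex fp_codes_hom_ex.

End Presentations.

(* Main.v *)
From mathcomp Require Import all_boot all_algebra.
From mathcomp Require Import boolp.
Require Import Defs.

Set Implicit Arguments.
Unset Strict Implicit.
Unset Printing Implicit Defensive.

Import GRing.Theory.
Local Open Scope ring_scope.
Local Open Scope category_scope.

(** The category is described by matrices: a morphism from [coker A] to
    [coker B] is a matrix [phi] with [A *m phi = Y *m B] for some [Y], and it is
    zero iff [phi = Z *m B] for some [Z].  So every construction comes down to
    one question, whether (and how) the rows of a matrix are combinations of
    the rows of another one; [spans] is this relation.

    Besides block matrices, the Abelian structure needs syzygies and division.
    The left half of the syzygies of [phi] stacked on [B] generates
    [{x | x *m phi is a relation of B}] ([relative_syzygies]).  Applied to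
    [phi] and [B] it gives generators [K] of the kernel; applied to [K] and the
    relations [A] of the source it gives the relations among these generators
    ([fp_kernel]).  A lift along the kernel embedding is a division by [K],
    done by deciding zero effectively.  The cokernel is presented by [phi]
    stacked on [B], with the identity matrix as projection, and a colift has
    the same matrix as the morphism it factors ([fp_cokernel]).  Sums are
    presented by block diagonal matrices ([fp_direct_sum]).  Testing
    monomorphisms on maps from free modules of rank 1, and epimorphisms on their
    cokernel, shows that both are normal ([fp_abelian]).

    Free modules are projective by choosing images of the generators, and the
    identity matrix is an epimorphism onto [coker A] from a free module
    ([free_projective], [free_cover]).  For a lift from an arbitrary projective
    [P] presented by [A], of [phi] along a morphism [eps] from [coker D] to
    [coker B], one needs a matrix [X] with

      [A *m X = Y *m D]   and   [X *m eps - phi = Z *m B].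

    The unknown [X] is multiplied on the right in one equation and on the left
    in the other, so over a noncommutative ring this is not a linear system that
    can be solved by syzygies.  But whether a given [X] is a solution is
    decidable, and a solution exists because [P] is projective: so a search
    through all matrices of the right size terminates ([lift_programP]).

    The algorithms themselves are written in a small language of programs, each
    a partial function bundled with the proof that it is computable; only their
    values have to be discussed. *)

(** * Row spaces over a noncommutative ring *)

Section RowSpaces.
Variable R : pzRingType.

Definition spans r q n (A : 'M[R]_(r, n)) (B : 'M[R]_(q, n)) : Prop :=
  exists T : 'M[R]_(q, r), B = T *m A.

Lemma spansP r q n (A : 'M[R]_(r, n)) (B : 'M[R]_(q, n)) :
  spans A B <-> forall x, rowsp A (x *m B).
Proof.
split=> [[T ->] x|H]; first by exists (x *m T); rewrite mulmxA.
have /choice[y Hy] : forall i, exists y, row i B = y *m A.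
  by move=> i; have [y Hy] := H (delta_mx 0 i); exists y; rewrite -Hy rowE.
exists (\matrix_i y i); apply/row_matrixP => i.
by rewrite row_mul rowK Hy.
Qed.

Lemma spans_row r q n (A : 'M[R]_(r, n)) (B : 'M[R]_(q, n)) i :
  spans A B -> rowsp A (row i B).
Proof. by move=> /spansP AB; rewrite rowE. Qed.

Lemma spans_col_mx r q p n (A : 'M[R]_(r, n)) (B : 'M[R]_(q, n))
    (D : 'M[R]_(p, n)) :
  spans (col_mx A B) D <-> exists u v, D = u *m A + v *m B.
Proof.
split=> [[w ->]|[u [v ->]]]; last by exists (row_mx u v); rewrite mul_row_col.
by exists (lsubmx w), (rsubmx w); rewrite -mul_row_col hsubmxK.
Qed.

Lemma rowsp_col_mx r q n (A : 'M[R]_(r, n)) (B : 'M[R]_(q, n)) x :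
  rowsp (col_mx A B) x <-> exists u v, x = u *m A + v *m B.
Proof. exact: spans_col_mx. Qed.

Lemma rowsp_diag r q n m (A : 'M[R]_(r, n)) (B : 'M[R]_(q, m)) x y :
  rowsp (block_mx A 0 0 B) (row_mx x y) <-> rowsp A x /\ rowsp B y.
Proof.
split=> [[w]|[[u ->] [v ->]]]; last first.
  by exists (row_mx u v); rewrite mul_row_block !mulmx0 addr0 add0r.
rewrite -[w]hsubmxK mul_row_block !mulmx0 addr0 add0r => /eq_row_mx[-> ->].
by split; [exists (lsubmx w) | exists (rsubmx w)].
Qed.

(** The rows of [K] generate the kernel of the map from the free module to
    [coker B] induced by [phi]. *)
Definition relative_syzygies m n q k (phi : 'M[R]_(m, n)) (B : 'M[R]_(q, n))
  (K : 'M[R]_(k, m)) : Prop := forall x, rowsp K x <-> rowsp B (x *m phi).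

Lemma syzygies_spans m n q k p (phi : 'M[R]_(m, n)) (B : 'M[R]_(q, n))
    (K : 'M[R]_(k, m)) (D : 'M[R]_(p, m)) :
  relative_syzygies phi B K -> spans K D <-> spans B (D *m phi).
Proof.
by move=> KP; rewrite !spansP; split=> H x; move: (H x); rewrite mulmxA KP.
Qed.

(** A syzygy [(x, y)] of [phi] stacked on [B] says [x *m phi = - y *m B]: its
    left part is what [phi] sends into the row space of [B]. *)
Lemma lsubmx_syzygies m q n k (phi : 'M[R]_(m, n)) (B : 'M[R]_(q, n))
    (K : 'M[R]_(k, m + q)) :
  (forall x, x *m col_mx phi B = 0 <-> rowsp K x) ->
  relative_syzygies phi B (lsubmx K).
Proof.
move=> KP x; split=> [[y ->]|[v xphi]].
  have /KP : rowsp K (y *m K) by exists y.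
  rewrite mulmx_lsub -[y *m K]hsubmxK mul_row_col row_mxKl => /eqP.
  by rewrite addr_eq0 -mulNmx => /eqP ->; exists (- rsubmx (y *m K)).
have /KP[y eqx] : row_mx x (- v) *m col_mx phi B = 0.
  by rewrite mul_row_col mulNmx xphi subrr.
by exists y; rewrite mulmx_lsub -eqx row_mxKl.
Qed.

End RowSpaces.

(** * Finite presentations in terms of matrices *)

Section Presentations.
Variable R : pzRingType.
Implicit Types X Y Z : ob (fpres R).

(** The number of generators of [X] is fixed here, so that presentations of one
    object have the same width by typing, although their heights may differ. *)
Definition presents r X (A : 'M[R]_(r, gens X)) : Prop :=
  forall x : 'rV_(gens X), rels x <-> rowsp A x.

Definition induces X Y (phi : 'M[R]_(gens X, gens Y)) (f : hom X Y) : Prop :=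
  fp_codes_hom (Mx phi) f.

Lemma presents_fpob r n (A : 'M[R]_(r, n)) : presents (X := fpob A) A.
Proof. exact: relsE. Qed.

(** Two morphisms may share an object without sharing its code.  Reading each
    code as a matrix of width [gens X] makes all their matrices composable. *)
Lemma codes_obP (d : data R DMat) X :
  fp_codes_ob d X <->
  exists r (A : 'M[R]_(r, gens X)), d = Mx A /\ presents A.
Proof.
split=> [<-|[r [A [-> pA]]]].
  by case: d => r n A; exists r, A; split=> //; exact: presents_fpob.
rewrite /fp_codes_ob /=.
case: X A pA => n a A pA.
transitivity (fpob (tagged (repr a))).
  by apply/fpob_eq => x; apply: iff_sym; exact: pA.
by rewrite -[a in RHS]reprK /fpob; congr existT; case: (repr a).
Qed.

Lemma presents_ex X : exists r (A : 'M[R]_(r, gens X)), presents A.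
Proof.
have [d /codes_obP[r [A [_ pA]]]] := fp_codes_ob_ex X.
by exists r, A.
Qed.

Lemma inducesP X Y (f : hom X Y) : exists phi, induces phi f.
Proof. by have [phi ->] := fphomP f; exists (val phi), phi. Qed.

Lemma induces_ex X Y (phi : 'M_(gens X, gens Y)) :
  (forall x, rels x -> rels (x *m phi)) -> exists f : hom X Y, induces phi f.
Proof.
by move=> /asboolP m; exists (fphom (exist _ phi m)), (exist _ phi m).
Qed.

Lemma induces_rels X Y phi (f : hom X Y) x :
  induces phi f -> rels x -> rels (x *m phi).
Proof. by move=> [p [/anymx_inj -> _]]; apply: (asboolP _ (valP p)). Qed.

Lemma induces_eq X Y phi psi (f g : hom X Y) :
  induces phi f -> induces psi g ->
  f = g <-> forall x, rels (x *m phi - x *m psi).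
Proof.
by move=> [p [/anymx_inj -> ->]] [q [/anymx_inj -> ->]]; exact: fphom_eq.
Qed.

Lemma induces_inj X Y phi (f g : hom X Y) :
  induces phi f -> induces phi g -> f = g.
Proof. exact: fp_codes_hom_inj. Qed.

Lemma induces0 X Y : induces 0 (0 : hom X Y).
Proof. by exists 0; split; last by rewrite /fphom raddf0. Qed.

Lemma inducesD X Y phi psi (f g : hom X Y) :
  induces phi f -> induces psi g -> induces (phi + psi) (f + g).
Proof.
move=> [p [/anymx_inj -> ->]] [q [/anymx_inj -> ->]]; exists (p + q).
by split; rewrite ?fphomD.
Qed.

Lemma inducesB X Y phi psi (f g : hom X Y) :
  induces phi f -> induces psi g -> induces (phi - psi) (f - g).
Proof.
move=> [p [/anymx_inj -> ->]] [q [/anymx_inj -> ->]]; exists (p - q).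
by split; rewrite /fphom ?raddfB.
Qed.

Lemma induces_id X : induces 1%:M (idm X).
Proof. by exists (fp_mx1 X). Qed.

Lemma induces_comp X Y Z phi psi (f : hom X Y) (g : hom Y Z) :
  induces phi f -> induces psi g -> induces (phi *m psi) (f ;; g).
Proof.
move=> [p [/anymx_inj -> ->]] [q [/anymx_inj -> ->]]; exists (fp_mxM p q).
by split=> //; exact: fp_compE.
Qed.

Lemma induces_eq0 X Y phi (f : hom X Y) :
  induces phi f -> f = 0 <-> forall x, rels (x *m phi).
Proof.
move=> fP; rewrite (induces_eq fP (induces0 X Y)).
by split=> H x; move: (H x); rewrite mulmx0 subr0.
Qed.

Lemma induces_eq0P X Y q (B : 'M_(q, gens Y)) phi (f : hom X Y) :
  presents B -> induces phi f -> f = 0 <-> spans B phi.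
Proof.
move=> pB fP; rewrite (induces_eq0 fP) spansP.
by split=> H x; [apply/pB | apply/pB].
Qed.

Lemma induces_exP X Y r (A : 'M_(r, gens X)) q (B : 'M_(q, gens Y)) phi :
  presents A -> presents B ->
  (exists f : hom X Y, induces phi f) <-> spans B (A *m phi).
Proof.
move=> pA pB; split=> [[f fP]|/spansP H].
  apply/spansP => u; rewrite mulmxA; apply/pB.
  by apply: (induces_rels fP); apply/pA; exists u.
by apply: induces_ex => x /pA[u ->]; apply/pB; rewrite -mulmxA.
Qed.

End Presentations.

Arguments presents_fpob {R r n} A.

(** * Biproducts and inclusion of images *)

Section Preadditive.
Variable A : preadditive.
Implicit Types L M N P S : ob A.

Lemma comp0m L M N (g : hom M N) : (0 : hom L M) ;; g = 0.
Proof. by apply: (addrI (0 ;; g)); rewrite -compDl !addr0. Qed.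

Lemma compm0 L M N (f : hom L M) : f ;; (0 : hom M N) = 0.
Proof. by apply: (addrI (f ;; 0)); rewrite -compDr !addr0. Qed.

Lemma biproduct A1 A2 S (i1 : hom A1 S) (i2 : hom A2 S)
    (p1 : hom S A1) (p2 : hom S A2) :
  i1 ;; p1 = idm A1 -> i2 ;; p2 = idm A2 -> i1 ;; p2 = 0 -> i2 ;; p1 = 0 ->
  p1 ;; i1 + p2 ;; i2 = idm S -> direct_sum i1 i2 p1 p2.
Proof.
move=> e11 e22 e12 e21 eS; split=> // M f1 f2.
- exists (p1 ;; f1 + p2 ;; f2); split.
    rewrite !compDr !compA e11 e12 e21 e22 !comp1m !comp0m.
    by rewrite addr0 add0r.
  by move=> f [<- <-]; rewrite !compA -compDl eS comp1m.
- exists (f1 ;; i1 + f2 ;; i2); split.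
    rewrite !compDl -!compA e11 e12 e21 e22 !compm1 !compm0.
    by rewrite addr0 add0r.
  by move=> f [<- <-]; rewrite -!compA -compDr eS compm1.
Qed.

(** Both images are kernels of cokernels: [g ;; c = 0] makes [c] factor through
    the cokernel of [g], which kills the image of [g] and hence that of [f]. *)
Lemma im_le_coker M M' N Q (f : hom M N) (g : hom M' N) (c : hom N Q) :
  im_le f g -> g ;; c = 0 -> f ;; c = 0.
Proof.
move=> [I [J [i [j [imf img [u eq_ij]]]]]] gc.
have [Qf [cf [[fcf _] [_ /(_ _ _ fcf)[f' [<- _]]]]]] := imf.
have [Qg [cg [[_ /(_ _ _ gc)[c' [<- _]]] [jcg _]]]] := img.
by rewrite -eq_ij -!compA (compA j) jcg comp0m !compm0.
Qed.

End Preadditive.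

(** * Kernels, cokernels and direct sums of presentations *)

Section Abelian.
Variable R : pzRingType.
Implicit Types L M N P X Y : ob (fpres R).

(** Since [K] generates all that [phi] sends to relations, a matrix [tau] of a
    morphism killed by [f] is a multiple of [K] on the nose, and the relations
    [D] are exactly what makes any such quotient [T] well defined and unique.
    The lift is stated for every [T], so that it holds for a computed one. *)
Lemma fp_kernel M N (phi : 'M[R]_(gens M, gens N)) (f : hom M N)
    r (A : 'M_(r, gens M)) q (B : 'M_(q, gens N))
    k (K : 'M_(k, gens M)) l (D : 'M_(l, k))
    (X := fpob D : ob (fpres R)) :
  presents A -> presents B -> induces phi f ->
  relative_syzygies phi B K -> relative_syzygies K A D ->
  exists kap : hom X M,
    [/\ induces (X := X) K kap, is_kernel f kap &
     forall L tau (t : hom L M) T, induces tau t -> tau = T *m K ->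
       exists2 t0 : hom L X, induces (Y := X) T t0 & t0 ;; kap = t].
Proof.
move=> pA pB fP KP DP.
have pD : presents (X := X) _ := presents_fpob D.
have [kap kapP] : exists kap : hom X M, induces (X := X) K kap.
  apply/(induces_exP _ pD pA); apply/(syzygies_spans _ DP).
  by exists 1%:M; rewrite mul1mx.
have lift L tau (t : hom L M) T : induces tau t -> tau = T *m K ->
    exists2 t0 : hom L X, induces (Y := X) T t0 & t0 ;; kap = t.
  move=> tP eq_tau.
  have [t0 t0P] : exists t0 : hom L X, induces (Y := X) T t0.
    apply: induces_ex => x /(induces_rels tP) /pA.
    by rewrite eq_tau mulmxA => /DP/pD.
  exists t0 => //; apply/(induces_eq (induces_comp t0P kapP) tP) => x.
  by rewrite eq_tau subrr; exact: rels0.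
exists kap; split=> //; split.
  apply/(induces_eq0P pB (induces_comp kapP fP)); apply/(syzygies_spans _ KP).
  by exists 1%:M; rewrite mul1mx.
move=> L t; have [tau tP] := inducesP t.
move/(induces_eq0P pB (induces_comp tP fP)) => /(syzygies_spans _ KP)[T eqT].
have [t0 t0P t0k] := lift _ _ _ _ tP eqT.
exists t0; split=> // t1; have [T1 t1P] := inducesP t1 => t1k.
apply/(induces_eq t0P t1P) => x; apply/pD/DP/pA; rewrite -mulmxBr.
have /(induces_eq (induces_comp t0P kapP) (induces_comp t1P kapP))/(_ x) :
  t0 ;; kap = t1 ;; kap by rewrite t0k t1k.
by rewrite -!mulmxBr -mulmxBl mulmxA.
Qed.

(** Adding the rows of [phi] to the relations leaves the generators alone, which
    is why [c] has the identity matrix and a colift the matrix of [h]. *)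
Lemma fp_cokernel M N (phi : 'M[R]_(gens M, gens N)) (f : hom M N)
    q (B : 'M_(q, gens N)) (Q := fpob (col_mx phi B) : ob (fpres R)) :
  presents B -> induces phi f ->
  exists c : hom N Q,
    [/\ induces (X := N) (Y := Q) 1%:M c, is_cokernel f c &
     forall L eta (h : hom N L), induces eta h -> f ;; h = 0 ->
       exists2 h0 : hom Q L, induces (X := Q) eta h0 & c ;; h0 = h].
Proof.
move=> pB fP; have pQ : presents (X := Q) _ := presents_fpob (col_mx phi B).
have [c cP] : exists c : hom N Q, induces (X := N) (Y := Q) 1%:M c.
  apply/(induces_exP _ pB pQ); rewrite mulmx1; apply/spans_col_mx.
  by exists 0, 1%:M; rewrite mul0mx mul1mx add0r.
have colift L eta (h : hom N L) : induces eta h -> f ;; h = 0 ->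
    exists2 h0 : hom Q L, induces (X := Q) eta h0 & c ;; h0 = h.
  move=> hP /(induces_eq0 (induces_comp fP hP)) fh.
  have [h0 h0P] : exists h0 : hom Q L, induces (X := Q) eta h0.
    apply: induces_ex => x /pQ /rowsp_col_mx[u [v ->]].
    rewrite mulmxDl; apply: relsD; first by rewrite -mulmxA.
    by apply: (induces_rels hP); apply/pB; exists v.
  exists h0 => //; apply/(induces_eq (induces_comp cP h0P) hP) => x.
  by rewrite mul1mx subrr; exact: rels0.
exists c; split=> //; split.
  apply/(induces_eq0P pQ (induces_comp fP cP)); rewrite mulmx1.
  by apply/spans_col_mx; exists 1%:M, 0; rewrite mul0mx mul1mx addr0.
move=> L h fh; have [eta hP] := inducesP h.
have [h0 h0P ch0] := colift _ _ _ hP fh.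
exists h0; split=> // h1 ch1; have [eta1 h1P] := inducesP h1.
apply/(induces_eq h0P h1P) => x.
have /(induces_eq (induces_comp cP h0P) (induces_comp cP h1P))/(_ x) :
  c ;; h0 = c ;; h1 by rewrite ch0 ch1.
by rewrite !mul1mx.
Qed.

Lemma fp_direct_sum (X1 X2 : ob (fpres R))
    r1 r2 (A1 : 'M_(r1, gens X1)) (A2 : 'M_(r2, gens X2))
    (S := fpob (block_mx A1 0 0 A2) : ob (fpres R)) :
  presents A1 -> presents A2 ->
  exists (i1 : hom X1 S) (i2 : hom X2 S) (p1 : hom S X1) (p2 : hom S X2),
  [/\ direct_sum i1 i2 p1 p2,
      induces (Y := S) (row_mx 1%:M 0) i1 /\
      induces (Y := S) (row_mx 0 1%:M) i2,
      induces (X := S) (col_mx 1%:M 0) p1 /\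
      induces (X := S) (col_mx 0 1%:M) p2,
      forall M phi1 phi2 (f1 : hom X1 M) (f2 : hom X2 M),
        induces phi1 f1 -> induces phi2 f2 -> exists2 f : hom S M,
          induces (X := S) (col_mx phi1 phi2) f & i1 ;; f = f1 /\ i2 ;; f = f2
    & forall M phi1 phi2 (f1 : hom M X1) (f2 : hom M X2),
        induces phi1 f1 -> induces phi2 f2 -> exists2 f : hom M S,
          induces (Y := S) (row_mx phi1 phi2) f & f ;; p1 = f1 /\ f ;; p2 = f2].
Proof.
move=> pA1 pA2.
have relsS (x1 : 'rV_(gens X1)) (x2 : 'rV_(gens X2)) :
    @rels _ S (row_mx x1 x2) <-> rels x1 /\ rels x2.
  by rewrite /S relsE rowsp_diag pA1 pA2.
have cop M phi1 phi2 (f1 : hom X1 M) (f2 : hom X2 M) :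
    induces phi1 f1 -> induces phi2 f2 ->
    exists f : hom S M, induces (X := S) (col_mx phi1 phi2) f.
  move=> f1P f2P; apply: induces_ex => x.
  have [x1 [x2 ->]] :
      exists (x1 : 'rV_(gens X1)) (x2 : 'rV_(gens X2)), x = row_mx x1 x2.
    by exists (lsubmx x), (rsubmx x); rewrite hsubmxK.
  move=> /relsS[r1x r2x]; rewrite mul_row_col.
  by apply: relsD; [exact: (induces_rels f1P) | exact: (induces_rels f2P)].
have prd M phi1 phi2 (f1 : hom M X1) (f2 : hom M X2) :
    induces phi1 f1 -> induces phi2 f2 ->
    exists f : hom M S, induces (Y := S) (row_mx phi1 phi2) f.
  move=> f1P f2P; apply: induces_ex => x rx.
  rewrite mul_mx_row; apply/relsS.
  by split; [exact: (induces_rels f1P) | exact: (induces_rels f2P)].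
have [i1 i1P] := prd _ _ _ _ _ (induces_id X1) (induces0 X1 X2).
have [i2 i2P] := prd _ _ _ _ _ (induces0 X2 X1) (induces_id X2).
have [p1 p1P] := cop _ _ _ _ _ (induces_id X1) (induces0 X2 X1).
have [p2 p2P] := cop _ _ _ _ _ (induces0 X1 X2) (induces_id X2).
have eq_mx X Y phi psi (f g : hom X Y) :
    induces phi f -> induces psi g -> phi = psi -> f = g.
  by move=> fP gP eq_phi; rewrite eq_phi in fP; exact: induces_inj gP.
exists i1, i2, p1, p2; split=> //.
- apply: biproduct.
  + apply: (eq_mx _ _ _ _ _ _ (induces_comp i1P p1P) (induces_id _)).
    by rewrite mul_row_col mul1mx mul0mx addr0.
  + apply: (eq_mx _ _ _ _ _ _ (induces_comp i2P p2P) (induces_id _)).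
    by rewrite mul_row_col mul1mx mul0mx add0r.
  + apply: (eq_mx _ _ _ _ _ _ (induces_comp i1P p2P) (induces0 _ _)).
    by rewrite mul_row_col mulmx0 mul0mx addr0.
  + apply: (eq_mx _ _ _ _ _ _ (induces_comp i2P p1P) (induces0 _ _)).
    by rewrite mul_row_col mulmx0 mul0mx addr0.
  + apply: (eq_mx _ _ _ _ _ _
             (inducesD (induces_comp p1P i1P) (induces_comp p2P i2P))
             (induces_id _)).
    rewrite !mul_col_row !mulmx0 !mul0mx !mul1mx add_block_mx !addr0 !add0r.
    by rewrite -scalar_mx_block.
- move=> M phi1 phi2 f1 f2 f1P f2P; have [f fP] := cop _ _ _ _ _ f1P f2P.
  exists f => //; split.
  + apply: (eq_mx _ _ _ _ _ _ (induces_comp i1P fP) f1P).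
    by rewrite mul_row_col mul1mx mul0mx addr0.
  + apply: (eq_mx _ _ _ _ _ _ (induces_comp i2P fP) f2P).
    by rewrite mul_row_col mul1mx mul0mx add0r.
- move=> M phi1 phi2 f1 f2 f1P f2P; have [f fP] := prd _ _ _ _ _ f1P f2P.
  exists f => //; split.
  + apply: (eq_mx _ _ _ _ _ _ (induces_comp fP p1P) f1P).
    by rewrite mul_row_col mulmx1 mulmx0 addr0.
  + apply: (eq_mx _ _ _ _ _ _ (induces_comp fP p2P) f2P).
    by rewrite mul_row_col mulmx1 mulmx0 add0r.
Qed.

(** * Free modules and projectivity *)

Definition free_module n : ob (fpres R) := fpob (0 : 'M[R]_(0, n)).

Lemma rels_free n (x : 'rV[R]_n) : @rels _ (free_module n) x -> x = 0.
Proof. by move=> /relsE[u ->]; rewrite mulmx0. Qed.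

Lemma free_hom n Y (phi : 'M_(n, gens Y)) :
  exists f : hom (free_module n) Y, induces (X := free_module n) phi f.
Proof.
by apply: induces_ex => x /rels_free ->; rewrite mul0mx; exact: rels0.
Qed.

(** Tested on the concrete cokernel of [g]: it kills [f], and its relations are
    those of [N] together with the rows of [eps]. *)
Lemma im_le_spans P M N phi eps (f : hom P N) (g : hom M N)
    q (B : 'M_(q, gens N)) : presents B -> induces phi f -> induces eps g ->
  im_le f g -> spans (col_mx eps B) phi.
Proof.
move=> pB fP gP fg.
have [c [cP [gc _] _]] := fp_cokernel pB gP.
have := im_le_coker fg gc.
by move/(induces_eq0P (presents_fpob _) (induces_comp fP cP)); rewrite mulmx1.
Qed.

Lemma free_projective n : projective (free_module n).
Proof.
move=> M N f g fg; have [phi fP] := inducesP f; have [eps gP] := inducesP g.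
have [q [B pB]] := presents_ex N.
have /spans_col_mx[u [v eqphi]] := im_le_spans pB fP gP fg.
have [h hP] := @free_hom n M u.
exists h; apply/(induces_eq (induces_comp hP gP) fP) => x; apply/pB.
exists (x *m (- v)).
by rewrite -mulmxBr eqphi opprD addNKr -mulNmx mulmxA.
Qed.

(** An element of [coker A] is a morphism from the free module of rank 1. *)
Lemma mono_rels M N phi (f : hom M N) x :
  mono f -> induces phi f -> rels (x *m phi) -> rels x.
Proof.
move=> mf fP xphi; have [h hP] := @free_hom 1 M x.
have /(induces_eq0 hP)/(_ 1%:M) : h = 0; last by rewrite mul1mx.
apply: mf; rewrite comp0m; apply/(induces_eq0 (induces_comp hP fP)) => y.
have [c ->] : exists c, y = c%:M by exists (y 0 0); exact: mx11_scalar.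
have [q [B pB]] := presents_ex N.
rewrite mulmxA; apply/pB; move/pB: xphi => [u xu]; exists (c%:M *m u).
by rewrite -!mulmxA xu.
Qed.

(** The cokernel of an epimorphism is zero, so all generators of its target are
    relations of that cokernel. *)
Lemma epi_spans M N phi (f : hom M N) q (B : 'M_(q, gens N)) :
  presents B -> epi f -> induces phi f -> spans (col_mx phi B) 1%:M.
Proof.
move=> pB ef fP; have [c [cP [fc _] _]] := fp_cokernel pB fP.
apply/(induces_eq0P (presents_fpob _) cP); apply: ef.
by rewrite fc compm0.
Qed.

Lemma free0_zero : zero_object (free_module 0).
Proof.
move=> M; split=> f; have [phi fP] := inducesP f.
  apply/(induces_eq0 fP) => x.
  by rewrite [x *m phi](thinmx0 (_ : 'rV_0)); exact: rels0.
apply/(induces_eq0 fP) => x.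
by rewrite [x](thinmx0 (_ : 'rV_0)) mul0mx; exact: rels0.
Qed.

Lemma free_cover M : exists2 nu : hom (free_module (gens M)) M,
  induces (X := free_module (gens M)) (Y := M) 1%:M nu & epi nu.
Proof.
have [nu nuP] := @free_hom (gens M) M 1%:M.
exists nu => // L g h; have [ga gP] := inducesP g; have [et hP] := inducesP h.
move/(induces_eq (induces_comp nuP gP) (induces_comp nuP hP)) => gh.
by apply/(induces_eq gP hP) => x; move: (gh x); rewrite !mul1mx.
Qed.

(** * The abelian category of finite presentations *)

(** For a mono [f], a morphism killed by the cokernel has a matrix
    [u *m phi + v *m B], and [u] is its factor.  For an epi [f],
    [1%:M = u *m phi + v *m B], so [u] is a section of [f] up to the kernel of
    [f]: a morphism with matrix [eta] that kills the kernel of [f] factors by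
    [u *m eta]. *)
Lemma fp_abelian :
  (forall m n (A : 'M[R]_(m, n)), exists k (K : 'M_(k, m)),
     forall x : 'rV_m, x *m A = 0 <-> rowsp K x) ->
  abelian (fpres R).
Proof.
move=> syz.
have relsyz m n q (phi : 'M[R]_(m, n)) (B : 'M[R]_(q, n)) :
    exists k (K : 'M[R]_(k, m)), relative_syzygies phi B K.
  have [k [K KP]] := syz _ _ (col_mx phi B).
  by exists k, (lsubmx K); exact: lsubmx_syzygies.
split.
- by exists (free_module 0); exact: free0_zero.
- move=> X1 X2; have [r1 [A1 pA1]] := presents_ex X1.
  have [r2 [A2 pA2]] := presents_ex X2.
  have [i1 [i2 [p1 [p2 [sum _ _ _ _]]]]] := fp_direct_sum pA1 pA2.
  by exists (fpob (block_mx A1 0 0 A2)), i1, i2, p1, p2.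
- move=> M N f; have [phi fP] := inducesP f.
  have [r [A pA]] := presents_ex M; have [q [B pB]] := presents_ex N.
  have [k [K KP]] := relsyz _ _ _ phi B; have [l [D DP]] := relsyz _ _ _ K A.
  have [kap [_ kapK _]] := fp_kernel pA pB fP KP DP.
  by exists (fpob D), kap.
- move=> M N f; have [phi fP] := inducesP f; have [q [B pB]] := presents_ex N.
  have [c [_ cC _]] := fp_cokernel pB fP.
  by exists (fpob (col_mx phi B)), c.
- move=> M N f mf; have [phi fP] := inducesP f.
  have [q [B pB]] := presents_ex N.
  have [c [cP [fc _] _]] := fp_cokernel pB fP.
  exists (fpob (col_mx phi B)), c; split=> // L t tc0.
  have [tau tP] := inducesP t.
  move: tc0 => /(induces_eq0P (presents_fpob _) (induces_comp tP cP)).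
  rewrite mulmx1 => /spans_col_mx[u [v eq_tau]].
  have uE : tau - u *m phi = v *m B by rewrite eq_tau addrC addKr.
  have [t0 t0P] : exists t0 : hom L M, induces u t0.
    apply: induces_ex => x rx; apply: (mono_rels mf fP).
    have -> : x *m u *m phi = x *m tau - x *m v *m B.
      by rewrite -!mulmxA -uE -mulmxBr subKr.
    apply: relsD; first exact: (induces_rels tP).
    by apply: relsN; apply/pB; exists (x *m v).
  have t0f : t0 ;; f = t.
    apply/(induces_eq (induces_comp t0P fP) tP) => x; apply/pB.
    exists (- (x *m v)).
    by rewrite mulNmx -mulmxA -uE mulmxBr opprB.
  by exists t0; split=> // t1 t1f; apply: mf; rewrite t0f t1f.
- move=> M N f ef; have [phi fP] := inducesP f.
  have [r [A pA]] := presents_ex M; have [q [B pB]] := presents_ex N.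
  have [k [K KP]] := relsyz _ _ _ phi B; have [l [D DP]] := relsyz _ _ _ K A.
  have [kap [kapP [kapf _] _]] := fp_kernel pA pB fP KP DP.
  exists (fpob D), kap; split=> // L h kaph; have [eta hP] := inducesP h.
  (* [h] kills every element that [f] kills, since [K] generates these. *)
  have h_ker (x : 'rV_(gens M)) : rels (x *m phi) -> rels (x *m eta).
    move/pB/KP => [y ->]; rewrite -mulmxA.
    by move/(induces_eq0 (induces_comp kapP hP)): kaph; apply.
  have /spans_col_mx[u [v eq1]] := epi_spans pB ef fP.
  have uE : u *m phi = 1%:M - v *m B by rewrite eq1 addrK.
  have relsvB (x : 'rV_(gens N)) : rels (x *m (v *m B)).
    by apply/pB; exists (x *m v); rewrite mulmxA.
  have [h0 h0P] : exists h0 : hom N L, induces (u *m eta) h0.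
    apply: induces_ex => x rx; rewrite mulmxA; apply: h_ker.
    rewrite -mulmxA uE mulmxBr mulmx1; apply: relsD => //.
    by apply: relsN; exact: relsvB.
  have fh0 : f ;; h0 = h.
    apply/(induces_eq (induces_comp fP h0P) hP) => x.
    rewrite !mulmxA -mulmxBl; apply: h_ker.
    rewrite mulmxBl -[_ *m u *m phi]mulmxA uE mulmxBr mulmx1 addrAC subrr add0r.
    by apply: relsN; exact: relsvB.
  by exists h0; split=> // h1 fh1; apply: ef; rewrite fh0 fh1.
Qed.

End Abelian.

(** * Programs *)

Section Programs.
Variables (R : pzRingType) (C : algorithms R).

(** A program with input type [s] also serves as an expression in a context of
    type [s], whose variables are the projections of [input]. *)
Record program s t := Program {
  run :> data R s -> option (data R t);
  computable_run : @computable R C s t run }.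

(** The operations are only known to have some computable realization; choice
    fixes one, so that it can be named inside other programs. *)
Definition program_of s t (Q : pfun R s t -> Prop)
    (H : exists2 f, computable C f & Q f) : program s t :=
  Program (s2valP (cid2 H)).

Lemma program_ofP s t (Q : pfun R s t -> Prop)
    (H : exists2 f, computable C f & Q f) : Q (program_of H).
Proof. exact: (s2valP' (cid2 H)). Qed.

Definition input s : program s s := Program (alg_id C s).
Definition call s t u (f : program t u) (e : program s t) : program s u :=
  Program (alg_comp (computable_run e) (computable_run f)).
Definition pair_ s t u (e : program s t) (f : program s u) :
    program s (t ** u) :=
  Program (alg_pair (computable_run e) (computable_run f)).
Definition fst_ s t u (e : program s (t ** u)) : program s t :=
  call (Program (alg_fst C t u)) e.
Definition snd_ s t u (e : program s (t ** u)) : program s u :=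
  call (Program (alg_snd C t u)) e.
Definition zero_ s : program s DNat :=
  call (Program (alg_zero C)) (Program (alg_tt C s)).
Definition rows_ s (e : program s DMat) : program s DNat :=
  call (Program (alg_rows C)) e.
Definition cols_ s (e : program s DMat) : program s DNat :=
  call (Program (alg_cols C)) e.
Definition mx0_ s (m n : program s DNat) : program s DMat :=
  call (Program (alg_mx0 C)) (pair_ m n).
Definition mx1_ s (n : program s DNat) : program s DMat :=
  call (Program (alg_mx1 C)) n.
Definition opp_ s (e : program s DMat) : program s DMat :=
  call (Program (alg_oppmx C)) e.
Definition add_ s (e f : program s DMat) : program s DMat :=
  call (program_of (alg_addmx C)) (pair_ e f).
Definition mul_ s (e f : program s DMat) : program s DMat :=
  call (program_of (alg_mulmx C)) (pair_ e f).
Definition row_mx_ s (e f : program s DMat) : program s DMat :=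
  call (program_of (alg_row_mx C)) (pair_ e f).
Definition col_mx_ s (e f : program s DMat) : program s DMat :=
  call (program_of (alg_col_mx C)) (pair_ e f).
Definition lsubmx_ s (n : program s DNat) (e : program s DMat) :
    program s DMat :=
  call (program_of (alg_lsubmx C)) (pair_ n e).
Definition eqmx_ s (e f : program s DMat) : program s DBool :=
  call (program_of (alg_eqmx C)) (pair_ e f).
Definition search_ s (p : program (s ** DMat) DBool) (m n : program s DNat) :
    program s DMat :=
  call (program_of (alg_search (computable_run p)))
    (pair_ (pair_ (input s) m) n).

Lemma run_call s t u (f : program t u) (e : program s t) x y :
  e x = Some y -> call f e x = f y.
Proof. by rewrite /= => ->. Qed.

Lemma run_pair s t u (e : program s t) (f : program s u) x y z :
  e x = Some y -> f x = Some z -> pair_ e f x = Some (y, z).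
Proof. by rewrite /= => -> /= ->. Qed.

Lemma run_fst s t u (e : program s (t ** u)) x y :
  e x = Some y -> fst_ e x = Some y.1.
Proof. by rewrite /= => ->. Qed.

Lemma run_snd s t u (e : program s (t ** u)) x y :
  e x = Some y -> snd_ e x = Some y.2.
Proof. by rewrite /= => ->. Qed.

Variables (s : dtype) (x : data R s).
Implicit Types e f : program s DMat.

Lemma run_rows e m n (A : 'M[R]_(m, n)) :
  e x = Some (Mx A) -> rows_ e x = Some m.
Proof. by rewrite /= => ->. Qed.

Lemma run_cols e m n (A : 'M[R]_(m, n)) :
  e x = Some (Mx A) -> cols_ e x = Some n.
Proof. by rewrite /= => ->. Qed.

Lemma run_mx0 (m n : program s DNat) i j :
  m x = Some i -> n x = Some j -> mx0_ m n x = Some (Mx (0 : 'M[R]_(i, j))).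
Proof. by rewrite /= => -> /= ->. Qed.

Lemma run_mx1 (n : program s DNat) i :
  n x = Some i -> mx1_ n x = Some (Mx (1%:M : 'M[R]_i)).
Proof. by rewrite /= => ->. Qed.

Lemma run_opp e m n (A : 'M[R]_(m, n)) :
  e x = Some (Mx A) -> opp_ e x = Some (Mx (- A)).
Proof. by rewrite /= => ->. Qed.

Lemma run_add e f m n (A B : 'M[R]_(m, n)) :
  e x = Some (Mx A) -> f x = Some (Mx B) -> add_ e f x = Some (Mx (A + B)).
Proof.
move=> eA fB; rewrite (run_call _ (run_pair eA fB)).
exact: (program_ofP (alg_addmx C)).
Qed.

Lemma run_mul e f m n p (A : 'M[R]_(m, n)) (B : 'M[R]_(n, p)) :
  e x = Some (Mx A) -> f x = Some (Mx B) -> mul_ e f x = Some (Mx (A *m B)).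
Proof.
move=> eA fB; rewrite (run_call _ (run_pair eA fB)).
exact: (program_ofP (alg_mulmx C)).
Qed.

Lemma run_row_mx e f m n p (A : 'M[R]_(m, n)) (B : 'M[R]_(m, p)) :
  e x = Some (Mx A) -> f x = Some (Mx B) ->
  row_mx_ e f x = Some (Mx (row_mx A B)).
Proof.
move=> eA fB; rewrite (run_call _ (run_pair eA fB)).
exact: (program_ofP (alg_row_mx C)).
Qed.

Lemma run_col_mx e f m n p (A : 'M[R]_(m, n)) (B : 'M[R]_(p, n)) :
  e x = Some (Mx A) -> f x = Some (Mx B) ->
  col_mx_ e f x = Some (Mx (col_mx A B)).
Proof.
move=> eA fB; rewrite (run_call _ (run_pair eA fB)).
exact: (program_ofP (alg_col_mx C)).
Qed.

Lemma run_lsubmx (n : program s DNat) e m n1 n2 (A : 'M[R]_(m, n1 + n2)) :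
  n x = Some n1 -> e x = Some (Mx A) -> lsubmx_ n e x = Some (Mx (lsubmx A)).
Proof.
move=> nn eA; rewrite (run_call _ (run_pair nn eA)).
exact: (program_ofP (alg_lsubmx C)).
Qed.

Lemma run_eqmx e f m n (A B : 'M[R]_(m, n)) :
  e x = Some (Mx A) -> f x = Some (Mx B) -> eqmx_ e f x = Some (A == B).
Proof.
move=> eA fB; rewrite (run_call _ (run_pair eA fB)).
exact: (program_ofP (alg_eqmx C)).
Qed.

Lemma run_search (p : program (s ** DMat) DBool) (em en : program s DNat) m n
    (P : 'M[R]_(m, n) -> Prop) :
  em x = Some m -> en x = Some n ->
  (forall A : 'M_(m, n), exists2 b : bool, p (x, Mx A) = Some b & b <-> P A) ->
  (exists A, P A) -> exists2 A, search_ p em en x = Some (Mx A) & P A.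
Proof.
move=> emE enE pP [A PA].
have inE : input s x = Some x by [].
rewrite (run_call _ (run_pair (run_pair inE emE) enE)).
have [||A' [-> pA']] := program_ofP (alg_search (computable_run p)) x m n.
- by move=> B; have [b pb _] := pP B; exists b.
- exists A; have [b -> bP] := pP A.
  by have -> : b = true by apply/bP.
exists A' => //; have [b] := pP A'; rewrite pA' => -[<-] bP.
exact/bP.
Qed.

Definition block_diag_ e f : program s DMat :=
  col_mx_ (row_mx_ e (mx0_ (rows_ e) (cols_ f)))
          (row_mx_ (mx0_ (rows_ f) (cols_ e)) f).

Lemma run_block_diag e f m n p q (A : 'M[R]_(m, n)) (B : 'M[R]_(p, q)) :
  e x = Some (Mx A) -> f x = Some (Mx B) ->
  block_diag_ e f x = Some (Mx (block_mx A 0 0 B)).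
Proof.
move=> eA fB; apply: run_col_mx; apply: run_row_mx => //; apply: run_mx0.
- exact: run_rows eA.
- exact: run_cols fB.
- exact: run_rows fB.
- exact: run_cols eA.
Qed.

Hypothesis HR : left_computable C.

Definition syzygies : program DMat DMat := program_of HR.1.
Definition decide_zero : program (DMat ** DMat) (DMat ** DMat) :=
  program_of HR.2.

Definition relative_syzygies_ e f : program s DMat :=
  lsubmx_ (rows_ e) (call syzygies (col_mx_ e f)).

Lemma run_relative_syzygies e f m n q (phi : 'M[R]_(m, n)) (B : 'M[R]_(q, n)) :
  e x = Some (Mx phi) -> f x = Some (Mx B) ->
  exists k (K : 'M[R]_(k, m)),
    relative_syzygies_ e f x = Some (Mx K) /\ relative_syzygies phi B K.
Proof.
move=> eP fP; have [k [K [KE KP]]] := program_ofP HR.1 _ _ (col_mx phi B).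
exists k, (lsubmx K); split; last exact: lsubmx_syzygies.
apply: run_lsubmx; first exact: run_rows eP.
by rewrite (run_call _ (run_col_mx eP fP)).
Qed.

(** Deciding zero returns [N = T *m A + B], which vanishes when [A] spans [B]:
    then [B = (- T) *m A], whence the sign. *)
Definition quotient_ e f : program s DMat :=
  opp_ (snd_ (call decide_zero (pair_ f e))).
Definition remainder_ e f : program s DMat :=
  fst_ (call decide_zero (pair_ f e)).

Lemma decide_zeroP r q n (A : 'M[R]_(r, n)) (B : 'M[R]_(q, n)) :
  exists (N : 'M[R]_(q, n)) (T : 'M[R]_(q, r)),
    [/\ decide_zero (Mx A, Mx B) = Some (Mx N, Mx T), N = T *m A + B
      & spans A B -> N = 0].
Proof.
have [N [T [NE NT N0]]] := program_ofP HR.2 _ _ _ A B.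
exists N, T; split=> // AB; apply/row_matrixP => i.
by rewrite row0 N0 //; exact: spans_row.
Qed.

Lemma run_quotient e f r q n (A : 'M[R]_(r, n)) (B : 'M[R]_(q, n)) :
  e x = Some (Mx B) -> f x = Some (Mx A) -> spans A B ->
  exists2 T : 'M[R]_(q, r), quotient_ e f x = Some (Mx T) & B = T *m A.
Proof.
move=> eB fA AB; have [N [T [NE NT /(_ AB) N0]]] := decide_zeroP A B.
exists (- T); last first.
  by move/eqP: NT; rewrite N0 eq_sym addrC addr_eq0 -mulNmx => /eqP.
have runNT : call decide_zero (pair_ f e) x = Some (Mx N, Mx T).
  by rewrite (run_call _ (run_pair fA eB)).
by apply: run_opp; exact: run_snd runNT.
Qed.

Lemma run_remainder e f r q n (A : 'M[R]_(r, n)) (B : 'M[R]_(q, n)) :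
  e x = Some (Mx B) -> f x = Some (Mx A) ->
  exists2 N : 'M[R]_(q, n),
    remainder_ e f x = Some (Mx N) & N = 0 <-> spans A B.
Proof.
move=> eB fA; have [N [T [NE NT N0]]] := decide_zeroP A B.
exists N; last first.
  split=> // N00; exists (- T).
  by move/eqP: NT; rewrite N00 eq_sym addrC addr_eq0 -mulNmx => /eqP.
have runNT : call decide_zero (pair_ f e) x = Some (Mx N, Mx T).
  by rewrite (run_call _ (run_pair fA eB)).
by exact: run_fst runNT.
Qed.

End Programs.

(** * The algorithms *)

Section Algorithms.
Variables (R : pzRingType) (C : algorithms R) (HR : left_computable C).
Implicit Types L M N P : ob (fpres R).

Definition arrow : dtype := DMat ** DMat ** DMat.

Definition arrow_ s (a f b : program C s DMat) : program C s arrow :=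
  pair_ (pair_ a f) b.
Definition source_ s (e : program C s arrow) : program C s DMat :=
  fst_ (fst_ e).
Definition matrix_ s (e : program C s arrow) : program C s DMat :=
  snd_ (fst_ e).
Definition target_ s (e : program C s arrow) : program C s DMat := snd_ e.

Lemma run_arrow s (a f b : program C s DMat) x A B D :
  a x = Some A -> f x = Some B -> b x = Some D ->
  arrow_ a f b x = Some (A, B, D).
Proof. by move=> aA fB bD; exact: run_pair (run_pair aA fB) bD. Qed.

(* The tactic starts with an attempt to unfold a named program into its arrow.
   After that the rule is chosen by the outermost operation as written: all
   operations are instances of [call], so trying them by unification would
   unfold programs down to that form. *)
Ltac evaluate := try eapply run_arrow; repeat lazymatch goal with
  | |- run (arrow_ _ _ _) _ = _ => eapply run_arrow
  | |- run (mx1_ _) _ = _ => eapply run_mx1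
  | |- run (mx0_ _ _) _ = _ => eapply run_mx0
  | |- run (opp_ _) _ = _ => eapply run_opp
  | |- run (add_ _ _) _ = _ => eapply run_add
  | |- run (mul_ _ _) _ = _ => eapply run_mul
  | |- run (row_mx_ _ _) _ = _ => eapply run_row_mx
  | |- run (col_mx_ _ _) _ = _ => eapply run_col_mx
  | |- run (block_diag_ _ _) _ = _ => eapply run_block_diag
  | |- run (rows_ _) _ = _ => eapply run_rows
  | |- run (cols_ _) _ = _ => eapply run_cols
  | _ => first [eassumption | reflexivity]
  end.

Notation codes := (codes_arr (A := fpres_coded R)).

Lemma codes_homP M N d (f : hom M N) :
  fp_codes_hom d f -> exists2 phi, d = Mx phi & induces phi f.
Proof. by move=> [p [-> ->]]; exists (val p) => //; exists p. Qed.

Lemma codes_arrE M N d (f : hom M N) : codes d f ->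
  exists r (A : 'M_(r, gens M)) phi q (B : 'M_(q, gens N)),
    [/\ d = (Mx A, Mx phi, Mx B), presents A, presents B & induces phi f].
Proof.
case: d => [[a h] b] [/= /codes_obP[r [A [-> pA]]] /codes_homP[phi -> fP]].
by move=> /codes_obP[q [B [-> pB]]]; exists r, A, phi, q, B.
Qed.

Lemma codes_arrI M N r (A : 'M_(r, gens M)) phi q (B : 'M_(q, gens N))
    (f : hom M N) :
  presents A -> presents B -> induces phi f -> codes (Mx A, Mx phi, Mx B) f.
Proof.
by move=> pA pB fP; split=> //=; apply/codes_obP; [exists r, A | exists q, B].
Qed.

Definition id_program : program C DMat arrow :=
  let a := input C DMat in arrow_ a (mx1_ (cols_ a)) a.

Lemma id_programP M d : fp_codes_ob d M ->
  returns id_program d (fun r => codes r (idm M)).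
Proof.
move=> /codes_obP[r [A [-> pA]]].
exists (Mx A, Mx (1%:M : 'M_(gens M)), Mx A); first by evaluate.
exact: codes_arrI (induces_id M).
Qed.

Notation fst_arrow := (fst_ (input C (arrow ** arrow))).
Notation snd_arrow := (snd_ (input C (arrow ** arrow))).

Definition comp_program : program C (arrow ** arrow) arrow :=
  arrow_ (source_ fst_arrow) (mul_ (matrix_ fst_arrow) (matrix_ snd_arrow))
    (target_ snd_arrow).

Lemma comp_programP L M N (f : hom L M) (g : hom M N) d e :
  codes d f -> codes e g ->
  returns comp_program (d, e) (fun r => codes r (f ;; g)).
Proof.
move=> /codes_arrE[a [A [phi [b [B [-> pA pB fP]]]]]].
move=> /codes_arrE[b' [B' [psi [c [D [-> _ pD gP]]]]]].
exists (Mx A, Mx (phi *m psi), Mx D); first by evaluate.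
by apply: codes_arrI => //; exact: induces_comp.
Qed.

Definition zero_program : program C (DMat ** DMat) arrow :=
  let a := fst_ (input C (DMat ** DMat)) in
  let b := snd_ (input C (DMat ** DMat)) in
  arrow_ a (mx0_ (cols_ a) (cols_ b)) b.

Lemma zero_programP M N d e : fp_codes_ob d M -> fp_codes_ob e N ->
  returns zero_program (d, e) (fun r => codes r (0 : hom M N)).
Proof.
move=> /codes_obP[r [A [-> pA]]] /codes_obP[q [B [-> pB]]].
exists (Mx A, Mx (0 : 'M_(gens M, gens N)), Mx B); first by evaluate.
exact: codes_arrI (induces0 M N).
Qed.

Definition add_program : program C (arrow ** arrow) arrow :=
  arrow_ (source_ fst_arrow) (add_ (matrix_ fst_arrow) (matrix_ snd_arrow))
    (target_ fst_arrow).

Lemma add_programP M N (f g : hom M N) d e : codes d f -> codes e g ->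
  returns add_program (d, e) (fun r => codes r (f + g)).
Proof.
move=> /codes_arrE[a [A [phi [b [B [-> pA pB fP]]]]]].
move=> /codes_arrE[a' [A' [psi [b' [B' [-> _ _ gP]]]]]].
exists (Mx A, Mx (phi + psi), Mx B); first by evaluate.
by apply: codes_arrI => //; exact: inducesD.
Qed.

Definition sub_program : program C (arrow ** arrow) arrow :=
  arrow_ (source_ fst_arrow)
    (add_ (matrix_ fst_arrow) (opp_ (matrix_ snd_arrow))) (target_ fst_arrow).

Lemma sub_programP M N (f g : hom M N) d e : codes d f -> codes e g ->
  returns sub_program (d, e) (fun r => codes r (f - g)).
Proof.
move=> /codes_arrE[a [A [phi [b [B [-> pA pB fP]]]]]].
move=> /codes_arrE[a' [A' [psi [b' [B' [-> _ _ gP]]]]]].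
exists (Mx A, Mx (phi - psi), Mx B); first by evaluate.
by apply: codes_arrI => //; exact: inducesB.
Qed.

Definition sum_program :
    program C (DMat ** DMat) (arrow ** arrow ** arrow ** arrow) :=
  let a := fst_ (input C (DMat ** DMat)) in
  let b := snd_ (input C (DMat ** DMat)) in
  let m := cols_ a in let n := cols_ b in
  pair_ (pair_ (pair_
    (arrow_ a (row_mx_ (mx1_ m) (mx0_ m n)) (block_diag_ a b))
    (arrow_ b (row_mx_ (mx0_ n m) (mx1_ n)) (block_diag_ a b)))
    (arrow_ (block_diag_ a b) (col_mx_ (mx1_ m) (mx0_ n m)) a))
    (arrow_ (block_diag_ a b) (col_mx_ (mx0_ m n) (mx1_ n)) b).

Definition coproduct_program : program C (arrow ** arrow) arrow :=
  arrow_ (block_diag_ (source_ fst_arrow) (source_ snd_arrow))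
    (col_mx_ (matrix_ fst_arrow) (matrix_ snd_arrow)) (target_ fst_arrow).

Definition product_program : program C (arrow ** arrow) arrow :=
  arrow_ (source_ fst_arrow)
    (row_mx_ (matrix_ fst_arrow) (matrix_ snd_arrow))
    (block_diag_ (target_ fst_arrow) (target_ snd_arrow)).

Lemma sum_programP (X1 X2 : ob (fpres R)) a1 a2 :
  fp_codes_ob a1 X1 -> fp_codes_ob a2 X2 ->
  exists (S : ob (fpres R)) (i1 : hom X1 S) (i2 : hom X2 S)
         (p1 : hom S X1) (p2 : hom S X2),
  [/\ returns sum_program (a1, a2) (fun r =>
        (codes r.1.1.1 i1 /\ codes r.1.1.2 i2) /\
        (codes r.1.2 p1 /\ codes r.2 p2)),
      direct_sum i1 i2 p1 p2,
      forall M (f1 : hom X1 M) (f2 : hom X2 M) h1 h2 m1 m2,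
        codes (a1, h1, m1) f1 -> codes (a2, h2, m2) f2 ->
        returns coproduct_program ((a1, h1, m1), (a2, h2, m2)) (fun r =>
          exists2 f : hom S M, codes r f & i1 ;; f = f1 /\ i2 ;; f = f2)
    & forall M (f1 : hom M X1) (f2 : hom M X2) h1 h2 m1 m2,
        codes (m1, h1, a1) f1 -> codes (m2, h2, a2) f2 ->
        returns product_program ((m1, h1, a1), (m2, h2, a2)) (fun r =>
          exists2 f : hom M S, codes r f & f ;; p1 = f1 /\ f ;; p2 = f2)].
Proof.
move=> /codes_obP[r1 [A1 [-> pA1]]] /codes_obP[r2 [A2 [-> pA2]]].
have [i1 [i2 [p1 [p2 [sumS [i1P i2P] [p1P p2P] cop prd]]]]] :=
  fp_direct_sum pA1 pA2.
pose B := block_mx A1 0 0 A2; have pS := presents_fpob B.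
exists (fpob B), i1, i2, p1, p2; split=> //.
- rewrite /returns; eexists.
    apply: run_pair; last by evaluate.
    by apply: run_pair; [apply: run_pair; evaluate | evaluate].
  by split; split=> /=; apply: codes_arrI.
- move=> M f1 f2 h1 h2 m1 m2 [_ h1P mP] [_ h2P _].
  have [r [A [-> pA]]] := (codes_obP m1 M).1 mP.
  have [phi1 -> f1P] := codes_homP (d := h1) h1P.
  have [phi2 -> f2P] := codes_homP (d := h2) h2P.
  have [f fP eqf] := cop _ _ _ _ _ f1P f2P.
  exists (Mx B, Mx (col_mx phi1 phi2), Mx A); first by evaluate.
  by exists f => //; exact: codes_arrI.
- move=> M f1 f2 h1 h2 m1 m2 [mP h1P _] [_ h2P _].
  have [r [A [-> pA]]] := (codes_obP m1 M).1 mP.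
  have [phi1 -> f1P] := codes_homP (d := h1) h1P.
  have [phi2 -> f2P] := codes_homP (d := h2) h2P.
  have [f fP eqf] := prd _ _ _ _ _ f1P f2P.
  exists (Mx A, Mx (row_mx phi1 phi2), Mx B); first by evaluate.
  by exists f => //; exact: codes_arrI.
Qed.

Definition kernel_program : program C arrow arrow :=
  let f := input C arrow in
  let k := relative_syzygies_ HR (matrix_ f) (target_ f) in
  arrow_ (relative_syzygies_ HR k (source_ f)) k (source_ f).

(** The lift calls the kernel program on the first arrow: many matrices generate
    the same kernel, and the quotient must be by the one that was returned. *)
Definition kernel_lift_program : program C (arrow ** arrow) arrow :=
  let k := call kernel_program fst_arrow in
  arrow_ (source_ snd_arrow) (quotient_ HR (matrix_ snd_arrow) (matrix_ k))
    (source_ k).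

Lemma kernel_programP M N (f : hom M N) d : codes d f ->
  exists K (k : hom K M),
  [/\ returns kernel_program d (fun r => codes r k), is_kernel f k
    & forall L (t : hom L M) e, codes e t -> t ;; f = 0 ->
        returns kernel_lift_program (d, e) (fun r =>
          exists2 t0 : hom L K, codes r t0 & t0 ;; k = t)].
Proof.
move=> /codes_arrE[a [A [phi [b [B [-> pA pB fP]]]]]].
pose x : data R arrow := (Mx A, Mx phi, Mx B); rewrite -/x.
have [k [K [runK KP]]] : exists k (K : 'M[R]_(k, gens M)),
    relative_syzygies_ HR (matrix_ (input C arrow)) (target_ (input C arrow)) x
      = Some (Mx K) /\ relative_syzygies phi B K.
  exact: run_relative_syzygies.
have [l [D [runD DP]]] := run_relative_syzygies HR runK
  (erefl : source_ (input C arrow) x = Some (Mx A)).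
have runk : kernel_program x = Some (Mx D, Mx K, Mx A) by evaluate.
have [kap [kapP kapK lift]] := fp_kernel pA pB fP KP DP.
have pD := presents_fpob D.
exists (fpob D), kap; split=> //.
  by exists (Mx D, Mx K, Mx A) => //; exact: codes_arrI.
move=> L t _ /codes_arrE[c [E [tau [a' [A' [-> pE _ tP]]]]]] tf.
have runk' z : call kernel_program fst_arrow (x, z) = Some (Mx D, Mx K, Mx A).
  by rewrite (run_call _ (y := x)).
have [T runT eqT] : exists2 T : 'M[R]_(gens L, k),
    quotient_ HR (matrix_ snd_arrow) (matrix_ (call kernel_program fst_arrow))
      (x, (Mx E, Mx tau, Mx A')) = Some (Mx T) & tau = T *m K.
  apply: run_quotient => //.
  - exact: run_snd (run_fst (runk' _)).
  - apply/(syzygies_spans _ KP).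
    by apply/(induces_eq0P pB (induces_comp tP fP)).
have [t0 t0P t0k] := lift _ _ _ _ tP eqT.
exists (Mx E, Mx T, Mx D); last by exists t0 => //; exact: codes_arrI.
by apply: run_arrow => //; exact: run_fst (run_fst (runk' _)).
Qed.

Definition cokernel_program : program C arrow arrow :=
  let f := input C arrow in
  arrow_ (target_ f) (mx1_ (cols_ (target_ f)))
    (col_mx_ (matrix_ f) (target_ f)).

Definition cokernel_colift_program : program C (arrow ** arrow) arrow :=
  arrow_ (col_mx_ (matrix_ fst_arrow) (target_ fst_arrow))
    (matrix_ snd_arrow) (target_ snd_arrow).

Lemma cokernel_programP M N (f : hom M N) d : codes d f ->
  exists Q (c : hom N Q),
  [/\ returns cokernel_program d (fun r => codes r c), is_cokernel f c
    & forall L (h : hom N L) e, codes e h -> f ;; h = 0 ->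
        returns cokernel_colift_program (d, e) (fun r =>
          exists2 h0 : hom Q L, codes r h0 & c ;; h0 = h)].
Proof.
move=> /codes_arrE[a [A [phi [b [B [-> pA pB fP]]]]]].
have [c [cP cC colift]] := fp_cokernel pB fP.
have pQ := presents_fpob (col_mx phi B).
exists (fpob (col_mx phi B)), c; split=> //.
  exists (Mx B, Mx (1%:M : 'M_(gens N)), Mx (col_mx phi B)); first by evaluate.
  exact: codes_arrI.
move=> L h _ /codes_arrE[b' [B' [eta [l [D [-> _ pD hP]]]]]] fh.
have [h0 h0P ch0] := colift _ _ _ hP fh.
exists (Mx (col_mx phi B), Mx eta, Mx D); first by evaluate.
by exists h0 => //; exact: codes_arrI.
Qed.

(** Programs have no connectives on booleans, so the two conditions on [X] are
    tested at once: both remainders vanish iff their block diagonal sum does.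
    Comparing [D] with [D - D] spares the computation of its size. *)
Definition lift_test : program C (arrow ** arrow ** DMat) DBool :=
  let fg := fst_ (input C (arrow ** arrow ** DMat)) in
  let f := fst_ fg in let g := snd_ fg in
  let X := snd_ (input C (arrow ** arrow ** DMat)) in
  let D := block_diag_
    (remainder_ HR (mul_ (source_ f) X) (source_ g))
    (remainder_ HR (add_ (mul_ X (matrix_ g)) (opp_ (matrix_ f)))
      (target_ f)) in
  eqmx_ D (add_ D (opp_ D)).

Definition lift_program : program C (arrow ** arrow) arrow :=
  arrow_ (source_ fst_arrow)
    (search_ lift_test (cols_ (source_ fst_arrow)) (cols_ (source_ snd_arrow)))
    (source_ snd_arrow).

Lemma lift_testP p n m a b c b' (A : 'M[R]_(a, p)) (phi : 'M[R]_(p, n))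
    (B : 'M[R]_(b, n)) (D : 'M[R]_(c, m)) (eps : 'M[R]_(m, n))
    (B' : 'M[R]_(b', n)) (X : 'M[R]_(p, m)) :
  exists2 t : bool,
    lift_test ((Mx A, Mx phi, Mx B), (Mx D, Mx eps, Mx B'), Mx X) = Some t
    & t <-> spans D (A *m X) /\ spans B (X *m eps - phi).
Proof.
set x := (_, _, _).
pose fg := fst_ (input C (arrow ** arrow ** DMat)).
pose Xp := snd_ (input C (arrow ** arrow ** DMat)).
have [N1 run1 N1P] : exists2 N1 : 'M[R]_(a, m),
    remainder_ HR (mul_ (source_ (fst_ fg)) Xp) (source_ (snd_ fg)) x
      = Some (Mx N1)
    & N1 = 0 <-> spans D (A *m X).
  by apply: run_remainder; evaluate.
have [N2 run2 N2P] : exists2 N2 : 'M[R]_(p, n),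
    remainder_ HR
      (add_ (mul_ Xp (matrix_ (snd_ fg))) (opp_ (matrix_ (fst_ fg))))
      (target_ (fst_ fg)) x = Some (Mx N2)
    & N2 = 0 <-> spans B (X *m eps - phi).
  by apply: run_remainder; evaluate.
pose N := block_mx N1 0 0 N2.
exists (N == N - N); first by apply: run_eqmx; evaluate.
rewrite subrr -N1P -N2P /N.
split=> [/eqP N0|[-> ->]]; last by rewrite block_mx0.
by have [-> _ _ ->] := eq_block_mx (etrans N0 (esym (block_mx0 _ _ _ _ _))).
Qed.

(** A matrix of the lift given by projectivity is a solution of [lift_test];
    conversely any solution found induces a lift. *)
Lemma lift_programP P M N (f : hom P N) (g : hom M N) d e :
  projective P -> codes d f -> codes e g -> im_le f g ->
  returns lift_program (d, e) (fun r =>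
    exists2 f1 : hom P M, codes r f1 & f1 ;; g = f).
Proof.
move=> projP /codes_arrE[a [A [phi [b [B [-> pA pB fP]]]]]].
move=> /codes_arrE[c [D [eps [b' [B' [-> pD _ gP]]]]]] fg.
have [||||X runX [DX BX]] := @run_search R C (arrow ** arrow)
  ((Mx A, Mx phi, Mx B), (Mx D, Mx eps, Mx B')) lift_test
  (cols_ (source_ fst_arrow)) (cols_ (source_ snd_arrow)) (gens P) (gens M)
  (fun X => spans D (A *m X) /\ spans B (X *m eps - phi)).
- by evaluate.
- by evaluate.
- by move=> X; exact: lift_testP.
- have [f1 f1g] := projP _ _ _ _ fg; have [X f1P] := inducesP f1.
  exists X; split; first by apply/(induces_exP _ pA pD); exists f1.
  apply/spansP => x; apply/pB; move: f1g.
  by move/(induces_eq (induces_comp f1P gP) fP)/(_ x); rewrite mulmxBr.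
have [f1 f1P] : exists f1 : hom P M, induces X f1.
  exact/(induces_exP _ pA pD).
exists (Mx A, Mx X, Mx D); first by evaluate.
exists f1; first exact: codes_arrI.
apply/(induces_eq (induces_comp f1P gP) fP) => x.
by rewrite -mulmxBr; apply/pB; move/spansP: BX.
Qed.

Definition hull_program : program C DMat arrow :=
  let a := input C DMat in
  arrow_ (mx0_ (zero_ C DMat) (cols_ a)) (mx1_ (cols_ a)) a.

Lemma hull_programP M d : fp_codes_ob d M ->
  returns hull_program d (fun r => exists P (nu : hom P M),
    [/\ codes r nu, epi nu & projective P]).
Proof.
move=> /codes_obP[r [A [-> pA]]]; have [nu nuP nuE] := free_cover M.
exists (Mx (0 : 'M_(0, gens M)), Mx (1%:M : 'M_(gens M)), Mx A).
  by evaluate.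
exists (free_module R (gens M)), nu; split=> //; last exact: free_projective.
exact: codes_arrI (presents_fpob _) pA nuP.
Qed.

End Algorithms.

Theorem theorem3p4 (R : pzRingType) (C : algorithms R) (HR : left_computable C) :
  computable_abelian_enough_projectives C (fpres_coded R).
Proof.
have syz m n (A : 'M[R]_(m, n)) : exists k (K : 'M[R]_(k, m)),
    forall x, x *m A = 0 <-> rowsp K x.
  have [[syz _ syzP] _] := HR; have [k [K [_ KP]]] := syzP _ _ A.
  by exists k, K.
split.
- split; first exact: fp_abelian.
  + exists (id_program C); [exact: computable_run | exact: id_programP].
  + exists (comp_program C); [exact: computable_run | exact: comp_programP].
  + exists (mx0_ (zero_ C DUnit) (zero_ C DUnit)); first exact: computable_run.
    exists (Mx (0 : 'M_(0, 0))) => //; exists (free_module R 0) => //.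
    exact: free0_zero.
  + exists (zero_program C); [exact: computable_run | exact: zero_programP].
  + exists (add_program C); [exact: computable_run | exact: add_programP].
  + exists (sub_program C); [exact: computable_run | exact: sub_programP].
  + exists (sum_program C), (coproduct_program C), (product_program C).
    by split; [exact: computable_run.. | exact: sum_programP].
  + exists (kernel_program HR), (kernel_lift_program HR).
    by split; [exact: computable_run.. | exact: kernel_programP].
  + exists (cokernel_program C), (cokernel_colift_program C).
    by split; [exact: computable_run.. | exact: cokernel_programP].
- exists (lift_program HR); [exact: computable_run | exact: lift_programP].
- exists (hull_program C); [exact: computable_run | exact: hull_programP].
Qed.
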